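(* Let $\vec r=\{r_1,\dots,r_\ell\}$, $\vec s=\{s_1,\dots,s_\ell\}$ be any sequences of (possibly negative) integers with $\gcd(r_i,s_i)=1$. Define $a_1=s_1$ and $a_{i+1}=r_ir_{i+1}a_i+s_{i+1}$ for $1\le i\le\ell-1$, and let $$T(\vec r,\vec s)=\bigl(Cab(a_\ell,r_\ell)\cdots Cab(a_1,r_1)\bigr)(\bigcirc)$$ be the corresponding iterated torus knot ($\bigcirc$ is the unknot). Then for every $b\in\mathbb Z_{\ge0}$ the non-reduced DAHA-Jones polynomial of type $A_1$ at $t=q$ satisfies $$JD^{\#}_{\vec r,\vec s}(b;q,t\mapsto q)=q^{-\frac14a_\ell r_\ell\,b(b+2)}\;\mathcal J^{\#}_{T(\vec r,\vec s)}(b;q\mapsto q^{-1}),$$ where $\mathcal J^{\#}_K(b;q)$ is the non-reduced colored Jones polynomial of $K$.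
   Context: **Cabling.** $Cab(a,r)(K)$ is the knot obtained by placing the torus knot $T(a,r)$ on a small torus around the oriented knot $K$ in the direction of $K$, where $a$ gives the number of turns around $K$ (standard orientation, natural framing: the parallel copy of $K$ has zero linking number with $K$). **Colored Jones polynomials.** The non-reduced colored Jones polynomials of iterated torus knots are determined by $\mathcal J^{\#}_{\bigcirc}(b;q)=\dfrac{q^{(b+1)/2}-q^{-(b+1)/2}}{q^{1/2}-q^{-1/2}}$ and the cabling recursion $$\mathcal J^{\#}_{Cab(a,r)K}(b;q)=q^{-\frac14ar\,b(b+2)}\sum_{j=-b/2}^{b/2}q^{a\,j(jr+1)}\,\mathcal J^{\#}_K(2rj;q),$$ where $j$ runs with step $1$. For negative integers $m$ one uses $\mathcal J^{\#}_K(m;q)=-\mathcal J^{\#}_K(-m-2;q)$, $\mathcal J^{\#}_K(-1;q)=0$. **DAHA of type $A_1$.** $\mathcal H$ over $\mathbb Q(q^{1/4},t^{1/2})$ is generated by invertible $X,Y,T$ with $(T-t^{1/2})(T+t^{-1/2})=0$, $TXT=X^{-1}$, $T^{-1}YT^{-1}=Y^{-1}$, $Y^{-1}X^{-1}YXT^2q^{1/2}=1$. Automorphisms: $\tau_+$: $X\mapsto X$, $T\mapsto T$, $Y\mapsto q^{-1/4}XY$; $\tau_-$: $Y\mapsto Y$, $T\mapsto T$, $X\mapsto q^{1/4}YX$. The group $PSL_2^\wedge(\mathbb Z)$ generated by $\tau_\pm$ subject to $\tau_+\tau_-^{-1}\tau_+=\tau_-^{-1}\tau_+\tau_-^{-1}$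 projects onto $SL_2(\mathbb Z)$ by $\tau_+\mapsto\begin{pmatrix}1&1\\0&1\end{pmatrix}$, $\tau_-\mapsto\begin{pmatrix}1&0\\1&1\end{pmatrix}$. **Polynomial representation.** $\mathcal H$ acts on Laurent polynomials in $X$: $X$ by multiplication, $T=t^{1/2}s+(t^{1/2}-t^{-1/2})(X^2-1)^{-1}(s-1)$ with $s(X)=X^{-1}$, and $Y=\pi T$ with $\pi(f)(X)=f(q^{1/2}X^{-1})$. For $H\in\mathcal H$, $H\!\Downarrow=H(1)$, regarded again as an element of $\mathcal H$ (a Laurent polynomial in $X$). The coinvariant $\{H\}_{ev}$ is obtained by writing $H$ as a combination of $X^aT^\epsilon Y^b$ ($a,b\in\mathbb Z$, $\epsilon\in\{0,1\}$) and substituting $X\mapsto t^{-1/2}$, $Y\mapsto t^{1/2}$, $T\mapsto t^{1/2}$. **Non-reduced DAHA-Jones polynomials.** Let $P_b$ ($b\in\mathbb Z_{\ge0}$) be the Macdonald polynomial of type $A_1$ for the weight $b\omega_1$ (the symmetric Rogers polynomial with leading term $X^b+X^{-b}$ for $b>0$); at $t=q$ it is $\frac{X^{b+1}-X^{-b-1}}{X-X^{-1}}$. Choose $\gamma_i\in SL_2(\mathbb Z)$ with first column $(r_i,s_i)^{tr}$ and lifts $\hat\gamma_i\in PSL_2^\wedge(\mathbb Z)$. Then $$JD^{\#}_{\vec r,\vec s}(b;q,t)=\Bigl\{\hat\gamma_1\Bigl(\cdots\Bigl(\hat\gamma_{\ell-1}\Bigl(\bigl(\hat\gamma_\ell(P_b)\bigr)\!\Downarrow\Bigr)\!\Downarrow\Bigr)\cdots\Bigr)\Bigr\}_{ev},$$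 and $JD^{\#}_{\vec r,\vec s}(b;q,t\mapsto q)$ is this construction performed with $t=q$. *)

(* Defs.v *)
From HB Require Import structures.
From mathcomp Require Import all_boot all_order all_algebra.
From mathcomp Require Import ring zify.
From mathcomp Require Import finmap.
From mathcomp.multinomials Require Import monalg.

Set Implicit Arguments.
Unset Strict Implicit.
Unset Printing Implicit Defensive.

Import Order.TTheory GRing.Theory Num.Theory.

Local Open Scope ring_scope.

Inductive iterated_torus_knot : Type :=
| Unknot
| Cab of int & int & iterated_torus_knot.

(* The sequences r_1, ..., r_l and s_1, ..., s_l are indexed from 0:
   [r i] and [s i] stand for r_(i+1) and s_(i+1). *)
Fixpoint cable_coef (r s : nat -> int) (i : nat) : int :=
  if i is i'.+1 then r i' * r i * cable_coef r s i' + s i else s 0%N.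

(* Cab(a_(i+1), r_(i+1)) ... Cab(a_1, r_1) applied to the unknot. *)
Fixpoint torus_knot_iter (r s : nat -> int) (i : nat) : iterated_torus_knot :=
  Cab (cable_coef r s i) (r i)
      (if i is i'.+1 then torus_knot_iter r s i' else Unknot).

(* J(-1) = 0 and J(m) = - J(-m-2) for m < -1; recall Negz n = - (n + 1). *)
Definition odd_extension (K : fieldType) (J : nat -> K) (m : int) : K :=
  match m with
  | Posz n => J n
  | Negz 0 => 0
  | Negz n.+1 => - J n
  end.

(* u plays the role of q^(1/4).  With k = 2j = 2i - b, the summand
   q^(a j (j r + 1)) J(2 r j) becomes u^(a k (k r + 2)) J(r k). *)
Fixpoint colored_jones (K : fieldType) (u : K) (L : iterated_torus_knot)
    (b : nat) : K :=
  match L with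
  | Unknot =>
      (u ^+ (2 * b.+1) - u ^- (2 * b.+1)) / (u ^+ 2 - u ^- 2)
  | Cab a r L' =>
      u ^ (- (a * r * (b * (b + 2))%N%:Z)) *
      \sum_(i < b.+1)
        (let k : int := (2 * i)%N%:Z - b%:Z in
         u ^ (a * (k * (k * r + 2))) *
         odd_extension (colored_jones u L') (r * k))
  end.

Variant daha_gen := genX | genY | genT.

Definition daha_gen_code (g : daha_gen) : option bool :=
  match g with genX => None | genY => Some false | genT => Some true end.
Definition daha_gen_decode (c : option bool) : daha_gen :=
  match c with None => genX | Some false => genY | Some true => genT end.
Lemma daha_gen_codeK : cancel daha_gen_code daha_gen_decode.
Proof. by case. Qed.
HB.instance Definition _ := Countable.copy daha_gen (can_type daha_gen_codeK).

(* (g, false) is the generator g and (g, true) is its formal inverse. *)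
Definition daha_letter : choiceType := (daha_gen * bool)%type.

(* The free associative algebra on X, Y, T and their formal inverses. *)
Notation daha_free K := {malg K[{fmonom daha_letter}]}.

Definition letter_elt (K : fieldType) (x : daha_letter) : daha_free K :=
  << 1 *g fmu x >>.

Definition genpow (K : fieldType) (g : daha_gen) (n : int) : daha_free K :=
  match n with
  | Posz n => letter_elt K (g, false) ^+ n
  | Negz n => letter_elt K (g, true) ^+ n.+1
  end.

(* q4 stands for q^(1/4) and th for t^(1/2). *)
Variant daha_rel (K : fieldType) (q4 th : K) :
    daha_free K -> daha_free K -> Prop :=
| daha_mulgV g : daha_rel q4 th (genpow K g 1 * genpow K g (-1)) 1
| daha_mulVg g : daha_rel q4 th (genpow K g (-1) * genpow K g 1) 1
| daha_hecke :
    daha_rel q4 th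
      ((genpow K genT 1 - th *: 1) * (genpow K genT 1 + th^-1 *: 1)) 0
| daha_TXT :
    daha_rel q4 th (genpow K genT 1 * genpow K genX 1 * genpow K genT 1)
                   (genpow K genX (-1))
| daha_TYT :
    daha_rel q4 th (genpow K genT (-1) * genpow K genY 1 * genpow K genT (-1))
                   (genpow K genY (-1))
| daha_YXYX :
    daha_rel q4 th
      (q4 ^+ 2 *: (genpow K genY (-1) * genpow K genX (-1) * genpow K genY 1 *
                   genpow K genX 1 * genpow K genT 2)) 1.

(* The DAHA is the quotient of [daha_free K] by this congruence. *)
Inductive daha_eq (K : fieldType) (q4 th : K) :
    daha_free K -> daha_free K -> Prop :=
| daha_eq_rel h1 h2 : daha_rel q4 th h1 h2 -> daha_eq q4 th h1 h2
| daha_eq_refl h : daha_eq q4 th h h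
| daha_eq_sym h1 h2 : daha_eq q4 th h1 h2 -> daha_eq q4 th h2 h1
| daha_eq_trans h1 h2 h3 :
    daha_eq q4 th h1 h2 -> daha_eq q4 th h2 h3 -> daha_eq q4 th h1 h3
| daha_eq_add h1 h2 h1' h2' :
    daha_eq q4 th h1 h1' -> daha_eq q4 th h2 h2' ->
    daha_eq q4 th (h1 + h2) (h1' + h2')
| daha_eq_mul h1 h2 h1' h2' :
    daha_eq q4 th h1 h1' -> daha_eq q4 th h2 h2' ->
    daha_eq q4 th (h1 * h2) (h1' * h2').

Variant tau_gen := tau_plus | tau_minus.

(* Words in tau_+, tau_- and their inverses, (x, true) being the inverse of x.
   Each element of PSL_2^(Z) is represented by such words, and both [psl2_proj]
   and the action on the DAHA are compatible with the relation
   tau_+ tau_-^-1 tau_+ = tau_-^-1 tau_+ tau_-^-1, so that quantifying over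
   words amounts to quantifying over the group. *)
Definition psl2_word := seq (tau_gen * bool).

Definition tau_mx (x : tau_gen) : 'M[int]_2 :=
  match x with
  | tau_plus => 1 + delta_mx 0 1
  | tau_minus => 1 + delta_mx 1 0
  end.

Definition psl2_proj (w : psl2_word) : 'M[int]_2 :=
  \prod_(x <- w) (if x.2 then (tau_mx x.1)^-1 else tau_mx x.1).

(* Images of the letters.  Those of the inverse letters, and those under
   tau_+^-1 and tau_-^-1, are obtained by inverting
   tau_+(Y) = q^(-1/4) X Y and tau_-(X) = q^(1/4) Y X. *)
Definition tau_letter (K : fieldType) (q4 : K) (x : tau_gen * bool)
    (y : daha_letter) : daha_free K :=
  match x, y with
  | (tau_plus, false), (genY, false) => q4^-1 *: (genpow K genX 1 * genpow K genY 1)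
  | (tau_plus, false), (genY, true) => q4 *: (genpow K genY (-1) * genpow K genX (-1))
  | (tau_plus, true), (genY, false) => q4 *: (genpow K genX (-1) * genpow K genY 1)
  | (tau_plus, true), (genY, true) => q4^-1 *: (genpow K genY (-1) * genpow K genX 1)
  | (tau_minus, false), (genX, false) => q4 *: (genpow K genY 1 * genpow K genX 1)
  | (tau_minus, false), (genX, true) => q4^-1 *: (genpow K genX (-1) * genpow K genY (-1))
  | (tau_minus, true), (genX, false) => q4^-1 *: (genpow K genY (-1) * genpow K genX 1)
  | (tau_minus, true), (genX, true) => q4 *: (genpow K genX (-1) * genpow K genY 1)
  | _, _ => letter_elt K y
  end.

Definition tau_act (K : fieldType) (q4 : K) (x : tau_gen * bool)
    (h : daha_free K) : daha_free K :=
  mmap (fun c : K => c%:MP)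
       (fun w => \prod_(y <- fmonom_val w) tau_letter q4 x y) h.

Definition psl2_act (K : fieldType) (q4 : K) (w : psl2_word)
    (h : daha_free K) : daha_free K :=
  foldr (tau_act q4) h w.

(* Laurent polynomials in X: the free module on the powers X^k, k : int. *)
Notation laurent K := {malg K[int]}.

Definition Xpow (K : fieldType) (k : int) : laurent K := << 1 *g k >>.

(* The linear map sending X^k to F k. *)
Definition linext (K : fieldType) (V : lmodType K) (F : int -> V)
    (f : laurent K) : V :=
  \sum_(k <- msupp f) f@_k *: F k.

Definition opX (K : fieldType) (n : int) : laurent K -> laurent K :=
  linext (fun k => Xpow K (k + n)).

Definition ops (K : fieldType) : laurent K -> laurent K :=
  linext (fun k => Xpow K (- k)).

(* f(X) |-> f(q^(1/2) X^-1) *)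
Definition oppi (K : fieldType) (q4 : K) : laurent K -> laurent K :=
  linext (fun k => q4 ^ (2 * k) *: Xpow K (- k)).

(* (X^2 - 1)^-1 (s - 1), expanded on X^k; see [opdivE]. *)
Definition opdiv (K : fieldType) : laurent K -> laurent K :=
  linext (fun k => match k with
    | Posz n => - \sum_(i < n) Xpow K ((2 * i)%N%:Z - n%:Z)
    | Negz m => \sum_(i < m.+1) Xpow K ((2 * i)%N%:Z - m.+1%:Z)
    end).

Definition opT (K : fieldType) (th : K) (f : laurent K) : laurent K :=
  th *: ops f + (th - th^-1) *: opdiv f.

(* T^-1 = T - (t^(1/2) - t^(-1/2)) *)
Definition opTinv (K : fieldType) (th : K) (f : laurent K) : laurent K :=
  opT th f - (th - th^-1) *: f.

(* Y = pi T, and pi is an involution. *)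
Definition letter_op (K : fieldType) (q4 th : K) (y : daha_letter)
    (f : laurent K) : laurent K :=
  match y with
  | (genX, false) => opX 1 f
  | (genX, true) => opX (-1) f
  | (genT, false) => opT th f
  | (genT, true) => opTinv th f
  | (genY, false) => oppi q4 (opT th f)
  | (genY, true) => opTinv th (oppi q4 f)
  end.

Definition daha_act (K : fieldType) (q4 th : K) (h : daha_free K)
    (f : laurent K) : laurent K :=
  \sum_(w <- msupp h) h@_w *: foldr (letter_op q4 th) f (fmonom_val w).

(* H |-> H(1) *)
Definition daha_down (K : fieldType) (q4 th : K) (h : daha_free K) : laurent K :=
  daha_act q4 th h (Xpow K 0).

Definition laurent_elt (K : fieldType) : laurent K -> daha_free K :=
  linext (genpow K genX).

(* [is_coinvariant q4 th h c] : h can be written as a combination of the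
   X^m T^e Y^n whose image under X |-> t^(-1/2), Y |-> t^(1/2), T |-> t^(1/2)
   is c. *)
Definition is_coinvariant (K : fieldType) (q4 th : K) (h : daha_free K) (c : K) :
    Prop :=
  exists g : {malg K[(int * bool * int)%type]},
    daha_eq q4 th h
      (\sum_(x <- msupp g)
         g@_x *: (genpow K genX x.1.1 * genpow K genT (x.1.2 : nat)%:Z *
                  genpow K genY x.2)) /\
    c = \sum_(x <- msupp g)
          g@_x * (th^-1 ^ x.1.1 * th ^+ (x.1.2 : nat) * th ^ x.2).

(* The element under the outermost { }_ev, for lifts gam 0, ..., gam i and the
   innermost Laurent polynomial P. *)
Fixpoint daha_jones_elt (K : fieldType) (q4 th : K) (gam : nat -> psl2_word)
    (i : nat) (P : laurent K) : daha_free K :=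
  let h := psl2_act q4 (gam i) (laurent_elt P) in
  if i is i'.+1 then daha_jones_elt q4 th gam i' (daha_down q4 th h) else h.

(* (X^(b+1) - X^(-b-1)) / (X - X^-1); see [macdonald_tqE]. *)
Definition macdonald_tq (K : fieldType) (b : nat) : laurent K :=
  \sum_(i < b.+1) Xpow K (b%:Z - (2 * i)%N%:Z).

(* "c is a value of JD#(b; q, t |-> q)", where u = q^(1/4); at t = q one has
   t^(1/2) = u^2. *)
Definition is_daha_jones_tq (K : fieldType) (u : K) (gam : nat -> psl2_word)
    (l b : nat) (c : K) : Prop :=
  is_coinvariant u (u ^+ 2)
    (daha_jones_elt u (u ^+ 2) gam l (macdonald_tq K b)) c.

(* The field Q(q^(1/4)) and q^(1/4) itself. *)
Definition Qq4 : fieldType := {fraction {poly rat}}.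
Definition q_quarter : Qq4 := tofrac 'X.

Lemma linextU (K : fieldType) (V : lmodType K) (F : int -> V) c k :
  linext F << c *g k >> = c *: F k.
Proof.
rewrite /linext msuppU; case: eqP => [->|_]; first by rewrite big_nil scale0r.
by rewrite big_seq_fset1 mcoeffUU.
Qed.

Lemma linextEw (K : fieldType) (V : lmodType K) (F : int -> V) (f : laurent K)
    (d : {fset int}) :
  (msupp f `<=` d)%fset -> linext F f = \sum_(k <- d) f@_k *: F k.
Proof.
move=> le; rewrite /linext; apply: big_fset_incl => // k _ /mcoeff_outdom ->.
by rewrite scale0r.
Qed.

Lemma linext_linear (K : fieldType) (V : lmodType K) (F : int -> V) :
  linear (linext F).
Proof.
move=> c f g.
pose d := (msupp (c *: f + g)%R `|` msupp f `|` msupp g)%fset.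
rewrite !(@linextEw _ _ _ _ d); first last.
- by rewrite /d -fsetUA fsubsetUl.
- by rewrite /d fsetUAC fsubsetUr.
- by rewrite /d fsubsetUr.
rewrite scaler_sumr -big_split /=; apply: eq_bigr => k _.
by rewrite mcoeffD mcoeffZ scalerDl scalerA.
Qed.

HB.instance Definition _ (K : fieldType) (V : lmodType K) (F : int -> V) :=
  GRing.isLinear.Build K (laurent K) V *:%R (linext F) (@linext_linear K V F).

Lemma eq_laurent_linear (K : fieldType) (V : lmodType K) (A B : laurent K -> V) :
  linear A -> linear B -> (forall k, A (Xpow K k) = B (Xpow K k)) -> A =1 B.
Proof.
move=> lA lB AB f.
pose A' : {linear laurent K -> V} := HB.pack A (GRing.isLinear.Build _ _ _ _ A lA).
pose B' : {linear laurent K -> V} := HB.pack B (GRing.isLinear.Build _ _ _ _ B lB).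
rewrite -[A]/(A' : _ -> _) -[B]/(B' : _ -> _) [f]monalgE !raddf_sum.
apply: eq_bigr => k _.
have -> : << f@_k *g k >> = f@_k *: Xpow K k :> laurent K.
  by apply/malgP => j; rewrite mcoeffZ !mcoeffU mulrnAr mulr1.
have ZA : A (f@_k *: Xpow K k) = f@_k *: A (Xpow K k) by exact: (linearZ_LR A').
have ZB : B (f@_k *: Xpow K k) = f@_k *: B (Xpow K k) by exact: (linearZ_LR B').
by rewrite /= ZA ZB AB.
Qed.

HB.instance Definition _ (K : fieldType) (n : int) :=
  GRing.isLinear.Build K (laurent K) (laurent K) *:%R (@opX K n)
    (linext_linear _).
HB.instance Definition _ (K : fieldType) :=
  GRing.isLinear.Build K (laurent K) (laurent K) *:%R (@ops K)
    (linext_linear _).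
HB.instance Definition _ (K : fieldType) (q4 : K) :=
  GRing.isLinear.Build K (laurent K) (laurent K) *:%R (@oppi K q4)
    (linext_linear _).
HB.instance Definition _ (K : fieldType) :=
  GRing.isLinear.Build K (laurent K) (laurent K) *:%R (@opdiv K)
    (linext_linear _).

Lemma opX_Xpow (K : fieldType) (n k : int) : opX n (Xpow K k) = Xpow K (k + n).
Proof. by rewrite /opX linextU scale1r. Qed.

Lemma Xpow_telescope (K : fieldType) (n : nat) (c : int) :
  opX 2 (\sum_(i < n) Xpow K ((2 * i)%N%:Z + c)) -
    \sum_(i < n) Xpow K ((2 * i)%N%:Z + c) =
  Xpow K ((2 * n)%N%:Z + c) - Xpow K c.
Proof.
elim: n => [|n IHn].
  by rewrite !big_ord0 subr0 linear0 muln0 add0r subrr.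
rewrite !big_ord_recr /= linearD /= opprD addrACA IHn opX_Xpow addrC.
have -> : (2 * n)%N%:Z + c + 2 = (2 * n.+1)%N%:Z + c by rewrite mulnS PoszD; ring.
by rewrite addrA subrK.
Qed.

(* (X^2 - 1) * opdiv f = s f - f *)
Lemma opdivE (K : fieldType) (f : laurent K) :
  opX 2 (opdiv f) - opdiv f = ops f - f.
Proof.
move: f; apply: eq_laurent_linear => [c f g|c f g|k].
- by rewrite !linearP /= addrACA -scalerDr.
- by rewrite !linearP /= addrACA -scalerDr.
rewrite /opdiv /ops !linextU !scale1r; case: k => n.
  rewrite linearN /= -opprD Xpow_telescope opprB; congr (_ - Xpow K _).
  by rewrite mul2n -addnn PoszD addrK.
rewrite Xpow_telescope NegzE opprK; congr (Xpow K _ - _).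
by rewrite mul2n -addnn PoszD addrK.
Qed.

Lemma oppiK (K : fieldType) (q4 : K) : q4 != 0 -> involutive (oppi q4).
Proof.
move=> q0; apply: eq_laurent_linear => [c f g|c f g|k]; rewrite ?linearP //.
rewrite {2}/oppi linextU scale1r linearZ /= /oppi linextU scale1r scalerA.
by rewrite -expfzDr // mulrN subrr expr0z scale1r opprK.
Qed.

(* (X - X^-1) * P_b = X^(b+1) - X^(-b-1) *)
Lemma macdonald_tqE (K : fieldType) (b : nat) :
  opX 1 (macdonald_tq K b) - opX (-1) (macdonald_tq K b) =
  Xpow K b.+1%:Z - Xpow K (- b.+1%:Z).
Proof.
rewrite /macdonald_tq (linear_sum (opX 1)) (linear_sum (opX (-1))) /=.
pose g i : laurent K := - Xpow K (b%:Z + 1 - (2 * i)%N%:Z).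
rewrite -sumrB (eq_bigr (fun i : 'I__ => g i.+1 - g i)) => [|i _].
  rewrite -(big_mkord xpredT (fun i => g i.+1 - g i)) telescope_sumr //.
  rewrite /g opprK addrC; congr (Xpow K _ - Xpow K _); lia.
rewrite /g opprK addrC !opX_Xpow; congr (- Xpow K _ + Xpow K _); lia.
Qed.

(* Main.v *)
Require Import Defs.
From HB Require Import structures.
From mathcomp Require Import all_boot all_order all_algebra.
From mathcomp Require Import ring zify finmap.
From mathcomp.multinomials Require Import monalg.
From mathcomp Require Import generic_quotient ring_quotient boolp.

(** The idea is that at [t = q] the part of the double affine Hecke algebra
    that acts on symmetric Laurent polynomials is the symmetric part of the
    quantum torus, on which the action of the modular group is monomial.

    Two reductions come first.  In the polynomial representation
    [T 1 = t^(1/2)] and [Y 1 = t^(1/2)], so the coinvariant of [H] must be the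
    value of [H 1] at [X = t^(-1/2)]; and every [H] has a coinvariant because
    the monomials [X^a T^e Y^b] span.  Hence [is_coinvariantE], after which the
    element to be computed is an iterate of the linear map [cable_step], that
    is [P |-> (gamma P) 1].

    To compute one step, let [D] be multiplication by the Weyl denominator
    [X - X^-1].  At [t = q], on vectors with [T v = t^(1/2) v], the operator [D]
    carries [X + X^-1], [Y + Y^-1] and [q^(-1/4) X Y + inverse] to
    [W(1,0) + W(-1,0)], [W(0,1) + W(0,-1)] and [W(1,1) + W(-1,-1)], where the
    [W(m,n)] are the Weyl-ordered monomials of the quantum torus; this is
    [polyrep_intertwined].  Composing an action with an automorphism [tau_+-]
    or its inverse preserves a statement of this shape and multiplies the matrix
    of exponents on the right by the matrix of that automorphism
    ([twist_intertwined]).  The reason is the skein-type relation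
    [mul_sumX_sumY], which resolves the product of two such sums in the Hecke
    algebra exactly as in the quantum torus.  Thus a lift of [gamma] with first
    column [(r, s)] makes [X + X^-1] act as [W(r,s) + W(-r,-s)], and [P_b], a
    polynomial in [X + X^-1], as the sum of the [W(k r, k s)] over
    [k = -b, -b + 2, ..., b].  Applying this to [D 1 = X - X^-1] and dividing by
    [D] gives [cable_step_macdonald]:
    [(gamma P_b) 1 = \sum_k q^(- k s (k r + 2) / 4) P_(k r)].

    This is the cabling recursion at [q^-1].  The remaining difference, that the
    torus knot of one step has slope [s_(i+1)] while the cable has
    [a_(i+1) = r_i r_(i+1) a_i + s_(i+1)], is absorbed by the factor
    [q^(- a_i r_i m (m + 2) / 4)] at [m = k r_(i+1)]; induction on the number of
    cables gives [jones_valueE]. *)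

Set Implicit Arguments.
Unset Strict Implicit.
Unset Printing Implicit Defensive.

Import Order.TTheory GRing.Theory Num.Theory.

Local Open Scope ring_scope.

(** * Actions of the free algebra *)

Section FreeAction.
Context {K : fieldType} {V : lmodType K}.
Implicit Types (op : daha_letter -> {linear V -> V}) (h : daha_free K) (v : V).

Definition act op h v : V :=
  \sum_(w <- msupp h) h@_w *: foldr (fun y => op y) v (fmonom_val w).

Lemma act_widen op h v (d : {fset {fmonom daha_letter}}) :
  (msupp h `<=` d)%fset ->
  act op h v = \sum_(w <- d) h@_w *: foldr (fun y => op y) v (fmonom_val w).
Proof.
move=> le; rewrite /act; apply: big_fset_incl => // k _ /mcoeff_outdom ->.
by rewrite scale0r.
Qed.

Lemma act_linear_l op v : linear (act op ^~ v).
Proof.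
move=> c f g.
pose d := (msupp (c *: f + g)%R `|` msupp f `|` msupp g)%fset.
rewrite !(@act_widen _ _ _ d); first last.
- by rewrite /d -fsetUA fsubsetUl.
- by rewrite /d fsetUAC fsubsetUr.
- by rewrite /d fsubsetUr.
rewrite scaler_sumr -big_split /=; apply: eq_bigr => k _.
by rewrite mcoeffD mcoeffZ scalerDl scalerA.
Qed.

Lemma actD op v : {morph act op ^~ v : h1 h2 / h1 + h2}.
Proof. by move=> f g; rewrite -[f]scale1r act_linear_l !scale1r. Qed.

Lemma act0 op v : act op 0 v = 0.
Proof. by rewrite /act msupp0 big_nil. Qed.

Lemma actZ op v c h : act op (c *: h) v = c *: act op h v.
Proof. by rewrite -[c *: h]addr0 act_linear_l act0 addr0. Qed.

Lemma act_sum op v (I : Type) (s : seq I) (P : pred I) (F : I -> daha_free K) :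
  act op (\sum_(i <- s | P i) F i) v = \sum_(i <- s | P i) act op (F i) v.
Proof. by apply: (big_morph (act op ^~ v)); [exact: actD | exact: act0]. Qed.

Lemma actU op v c w :
  act op << c *g w >> v = c *: foldr (fun y => op y) v (fmonom_val w).
Proof. by rewrite (act_widen _ _ msuppU_le) big_seq_fset1 mcoeffUU. Qed.

Lemma act_letter op v y : act op (letter_elt K y) v = op y v.
Proof. by rewrite /letter_elt actU scale1r fmuE. Qed.

Lemma foldr_linear op c v v' (s : seq daha_letter) :
  foldr (fun y => op y) (c *: v + v') s =
  c *: foldr (fun y => op y) v s + foldr (fun y => op y) v' s.
Proof. by elim: s => //= y s ->; rewrite linearP. Qed.

Lemma act_linear_r op h : linear (act op h).
Proof.
move=> c v v'; rewrite /act scaler_sumr -big_split /=; apply: eq_bigr => w _.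
by rewrite foldr_linear scalerDr !scalerA mulrC.
Qed.

Lemma act0r op h : act op h 0 = 0.
Proof. by have := act_linear_r op h (-1) 0 0; rewrite scaler0 add0r scaleN1r addNr. Qed.

Lemma actZr op h c v : act op h (c *: v) = c *: act op h v.
Proof. by rewrite -[c *: v]addr0 act_linear_r act0r addr0. Qed.

Lemma actM op h1 h2 v : act op (h1 * h2) v = act op h1 (act op h2 v).
Proof.
(* the words act linearly, also on the whole sum that defines [act op h2 v] *)
have lin w v' (I : Type) (s : seq I) (c : I -> K) (F : I -> V) :
    v' = \sum_(i <- s) c i *: F i ->
    foldr (fun y => op y) v' w = \sum_(i <- s) c i *: foldr (fun y => op y) (F i) w.
  move=> ->; elim: s => [|i s IHs].
    rewrite !big_nil; elim: w => //= y w ->; exact: linear0.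
  by rewrite !big_cons foldr_linear IHs.
rewrite malgME; apply: etrans (act_sum _ _ _ _ _) _.
rewrite {3}/act; apply: eq_bigr => w1 _.
apply: etrans (act_sum _ _ _ _ _) _.
rewrite (lin _ _ _ _ _ _ (erefl (act op h2 v))) scaler_sumr.
by apply: eq_bigr => w2 _; rewrite actU fmM foldr_cat scalerA.
Qed.

Lemma act1 op v : act op 1 v = v.
Proof. by rewrite actU scale1r fm1. Qed.

Lemma actC op v c : act op c%:MP v = c *: v.
Proof. by rewrite actU fm1. Qed.

(** The operators through which the letters act once an action has been
    composed with [tau_act x].  Twisting the operators rather than the element
    keeps every computation inside one module. *)
Definition twist (u : K) (x : tau_gen * bool) op (y : daha_letter) :
    {linear V -> V} :=
  let X := op (genX, false) in let X' := op (genX, true) in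
  let Y := op (genY, false) in let Y' := op (genY, true) in
  match x, y with
  | (tau_plus, false), (genY, false) => (u^-1 \*: (X \o Y))
  | (tau_plus, false), (genY, true) => (u \*: (Y' \o X'))
  | (tau_plus, true), (genY, false) => (u \*: (X' \o Y))
  | (tau_plus, true), (genY, true) => (u^-1 \*: (Y' \o X))
  | (tau_minus, false), (genX, false) => (u \*: (Y \o X))
  | (tau_minus, false), (genX, true) => (u^-1 \*: (X' \o Y'))
  | (tau_minus, true), (genX, false) => (u^-1 \*: (Y' \o X))
  | (tau_minus, true), (genX, true) => (u \*: (X' \o Y))
  | _, _ => op y
  end.

Lemma act_tau_letter u x op y v :
  act op (tau_letter u x y) v = twist u x op y v.
Proof.
by case: x y => [[] []] [[] []] /=; rewrite ?actZ ?actM !act_letter.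
Qed.

Lemma act_tau u x op h v : act op (tau_act u x h) v = act (twist u x op) h v.
Proof.
rewrite /tau_act mmapE act_sum; apply: eq_bigr => w _.
rewrite actM actC; congr (_ *: _).
elim: (fmonom_val w) => [|y s IHs] /=; first by rewrite big_nil act1.
by rewrite big_cons actM IHs act_tau_letter.
Qed.

(** Since [psl2_act] applies the last letter of the word first, the twists
    accumulate from the left. *)
Definition twists (u : K) (w : psl2_word) op : daha_letter -> {linear V -> V} :=
  foldl (fun op x => twist u x op) op w.

Lemma act_psl2 u w op h v :
  act op (psl2_act u w h) v = act (twists u w op) h v.
Proof. by elim: w op => //= x w IHw op; rewrite act_tau IHw. Qed.

End FreeAction.

(** * Modules over the double affine Hecke algebra *)

Lemma Negz_succ (k : nat) : Negz k.+1 + 1 = Negz k.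
Proof. by lia. Qed.

Section DahaModule.
Context {K : fieldType} {V : lmodType K} (u th : K).
Implicit Types (op : daha_letter -> {linear V -> V}) (v : V).

(** The relations are stated on vectors: applying operators to a vector makes
    associativity definitional. *)
Record daha_module op : Prop := DahaModule {
  mod_opK : forall g v, op (g, true) (op (g, false) v) = v;
  mod_opVK : forall g v, op (g, false) (op (g, true) v) = v;
  mod_hecke : forall v, op (genT, false) (op (genT, false) v) =
                        v + (th - th^-1) *: op (genT, false) v;
  mod_TXT : forall v, op (genT, false) (op (genX, false) (op (genT, false) v)) =
                      op (genX, true) v;
  mod_TYT : forall v, op (genT, true) (op (genY, false) (op (genT, true) v)) =
                      op (genY, true) v;
  mod_YXYX : forall v,
    u ^+ 2 *: op (genY, true) (op (genX, true) (op (genY, false)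
      (op (genX, false) (op (genT, false) (op (genT, false) v))))) = v
}.

Section Theory.
Variable op : daha_letter -> {linear V -> V}.
Hypotheses (u0 : u != 0) (th0 : th != 0) (opM : daha_module op).
Local Notation X := (op (genX, false)).
Local Notation X' := (op (genX, true)).
Local Notation Y := (op (genY, false)).
Local Notation Y' := (op (genY, true)).
Local Notation T := (op (genT, false)).
Local Notation T' := (op (genT, true)).

Let opK g v : op (g, true) (op (g, false) v) = v. Proof. exact: mod_opK. Qed.
Let opVK g v : op (g, false) (op (g, true) v) = v. Proof. exact: mod_opVK. Qed.

Lemma mod_XT v : X (T v) = T' (X' v).
Proof. by rewrite -(mod_TXT opM) opK. Qed.

Lemma mod_X'T' v : X' (T' v) = T (X v).
Proof. by rewrite -(mod_TXT opM) opVK. Qed.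

Lemma mod_TX' v : T (X' v) = X (T v) + (th - th^-1) *: X' v.
Proof. by rewrite -{1}(mod_TXT opM) (mod_hecke opM) (mod_TXT opM). Qed.

Lemma mod_T'E v : T' v = T v - (th - th^-1) *: v.
Proof. by rewrite -{2 3}[v](opVK genT) (mod_hecke opM) addrK. Qed.

Lemma mod_TX v : T (X v) = X' (T v) - (th - th^-1) *: X' v.
Proof. by rewrite -mod_X'T' mod_T'E linearB linearZ. Qed.

Lemma mod_YT' v : Y (T' v) = T (Y' v).
Proof. by rewrite -(mod_TYT opM) opVK. Qed.

Lemma mod_Y'T v : Y' (T v) = T' (Y v).
Proof. by rewrite -(mod_TYT opM) opK. Qed.

Lemma mod_XY v : X (Y v) = u ^+ 2 *: Y (X (T (T v))).
Proof. by rewrite -{1}(mod_YXYX opM v) !linearZ /= !opVK. Qed.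

Lemma mod_Y'X' v : Y' (X' v) = u ^- 2 *: T' (T' (X' (Y' v))).
Proof.
have -> : X' (Y' v) = u ^+ 2 *: T (T (Y' (X' v))).
  by rewrite -{1}[v](opVK genX) -{1}[X' v](opVK genY) mod_XY !linearZ /= !opK.
by rewrite !linearZ /= !opK scalerA divff ?scale1r // expf_neq0.
Qed.

Lemma mod_X'Y v : X' (Y v) = u ^- 2 *: Y (T' (T' (X' v))).
Proof.
have -> : Y (T' (T' (X' v))) = u ^+ 2 *: X' (Y v).
  by rewrite -[LHS](opK genX) mod_XY !linearZ /= !opVK.
by rewrite scalerA mulVf ?scale1r // expf_neq0.
Qed.

Lemma mod_Y'X v : Y' (X v) = u ^+ 2 *: T' (X' (Y (T' v))).
Proof.
rewrite mod_X'Y !linearZ /= scalerA mulVf ?scale1r ?expf_neq0 //.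
by rewrite mod_X'T' opK mod_TYT.
Qed.

Local Notation pow g k := (act op (genpow K g k)).

Lemma mod_powS g k v : op (g, false) (pow g k v) = pow g (k + 1) v.
Proof.
case: k => [k|[|k]].
- by rewrite -PoszD addn1 /= exprS actM act_letter.
- by rewrite -[Negz 0 + 1]/(Posz 0) /= expr1 act_letter act1 opVK.
by rewrite Negz_succ /= exprS actM act_letter opVK.
Qed.

Lemma mod_powSr g k v : pow g k (op (g, false) v) = pow g (k + 1) v.
Proof.
case: k => [k|[|k]].
- by rewrite -PoszD addn1 /= exprSr actM act_letter.
- by rewrite -[Negz 0 + 1]/(Posz 0) /= expr1 act_letter act1 opK.
by rewrite Negz_succ /= exprSr actM act_letter opK.
Qed.

Lemma mod_powN g k v : op (g, true) (pow g k v) = pow g (k - 1) v.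
Proof. by rewrite -[k in LHS](subrK 1) -mod_powS opK. Qed.

Lemma mod_powNr g k v : pow g k (op (g, true) v) = pow g (k - 1) v.
Proof. by rewrite -[k in LHS](subrK 1) -mod_powSr opVK. Qed.

(** [X + X^-1] and [Y + Y^-1] commute with [T], hence preserve its
    eigenspaces. *)
Lemma mod_sumXT v : T (X v + X' v) = X (T v) + X' (T v).
Proof. by rewrite linearD /= mod_TX mod_TX' addrACA addNr addr0 addrC. Qed.

Lemma mod_sumYT v : T (Y v + Y' v) = Y (T v) + Y' (T v).
Proof.
rewrite mod_Y'T linearD /= -mod_YT' !mod_T'E linearB linearZ /=.
by rewrite addrCA.
Qed.

End Theory.

(** [X + X^-1] and [Y + Y^-1].  The third sum [q^(-1/4) X Y + inverse] is
    [sumY] of the action twisted by [tau_+], and its companion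
    [q^(1/4) X^-1 Y + inverse] is [sumY] of the action twisted by the inverse of
    [tau_+]. *)
Definition sumX op v := op (genX, false) v + op (genX, true) v.
Definition sumY op v := op (genY, false) v + op (genY, true) v.

(** Precomposing a module with [tau_+-] or an inverse gives a module again: [T] and one
    of [X], [Y] are fixed, so only the relations involving the other one need checking. *)
Lemma twist_module op x : u != 0 -> th != 0 -> daha_module op -> daha_module (twist u x op).
Proof.
move=> u0 th0 opM; have [opK opVK _ _ _ _] := opM.
have uu : u * u^-1 = 1 by rewrite divff.
have uV : u^-1 * u = 1 by rewrite mulVf.
have uVV : u * u ^- 2 = u^-1 by rewrite expr2 invfM mulVKf.
case: x => [[] []]; split.
(* the inverse pairs are formal, and the relations that do not involve the
   modified generator are unchanged; two relations remain in each case *)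
all: try by case=> v /=; rewrite ?linearZ /= ?scalerA ?uu ?uV ?scale1r ?opK ?opVK.
all: try exact: (mod_hecke opM).
all: try exact: (mod_TXT opM).
all: try exact: (mod_TYT opM).
all: move=> v /=; rewrite ?linearZ /= ?opK ?opVK.
- by rewrite (mod_Y'X u0 opM) scalerA expr2 mulKf.
- by rewrite !scalerA uV mul1r (mod_YXYX opM).
- by rewrite (mod_YT' opM) (mod_XT opM) (mod_Y'X' u0 opM) scalerA uVV.
- by rewrite !scalerA uu mul1r (mod_YXYX opM).
- by rewrite (mod_XT opM) -(mod_YT' opM) (mod_X'Y u0 opM) scalerA uVV.
- by rewrite !scalerA uu mul1r (mod_YXYX opM).
- rewrite (mod_XT opM) (mod_YT' opM) (mod_Y'X' u0 opM) !linearZ /= !opVK.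
  by rewrite scalerA [_ * u]mulrC uVV.
- by rewrite !scalerA uV mul1r (mod_YXYX opM).
Qed.

(** The product of two closed curves on the torus that meet once is the
    combination of its two smoothings.  After expansion the claim is
    [X Y^-1 + X^-1 Y^-1 = q^(1/2) Y^-1 X^-1 + q^(-1/2) Y^-1 X].  With
    [w = X^-1 Y^-1 v], passing [Y^-1] to the right produces the terms
    [- c T^-1 w] and [c T^-1 w], where [c = t^(1/2) - t^(-1/2)], and these
    cancel. *)
Lemma mul_sumX_sumY op v : u != 0 -> daha_module op ->
  sumX op (sumY op v) =
  u *: sumY (twist u (tau_plus, false) op) v +
  u^-1 *: sumY (twist u (tau_plus, true) op) v.
Proof.
move=> u0 opM; have [opK opVK hecke _ _ _] := opM.
rewrite /sumX /sumY /=; set c := th - th^-1.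
set w := op (genX, true) (op (genY, true) v).
have -> : op (genY, true) (op (genX, true) v) =
    u ^- 2 *: (w - c *: op (genT, true) w).
  by rewrite (mod_Y'X' u0 opM) [op (genT, true) (_ _)](mod_T'E opM) opVK.
have -> : op (genY, true) (op (genX, false) v) =
    u ^+ 2 *: (op (genX, false) (op (genY, true) v) + c *: op (genT, true) w).
  rewrite (mod_Y'X u0 opM) (mod_YT' opM) -(mod_XT opM) hecke linearD linearZ /=.
  by rewrite (mod_XT opM).
rewrite !scalerDr !scalerN !scalerA.
have [-> -> -> -> ->] : [/\ u * u^-1 = 1, u * u * u ^- 2 = 1, u^-1 * u = 1,
    u^-1 * u^-1 * u ^+ 2 = 1 & u^-1 * u^-1 * (u ^+ 2 * c) = c].
  by split; field.
rewrite !mul1r !scale1r !linearD /= -/w.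
rewrite [LHS]addrACA [RHS]addrACA; congr (_ + _).
by rewrite [RHS]addrACA addNr addr0 addrC.
Qed.

(** [T X Y T^-1 = X^-1 Y^-1] and [T^-1 Y X T = Y^-1 X^-1], so [T] conjugates
    [tau_-(X)] to the inverse of [tau_+(Y)], and the corresponding sums agree on
    eigenvectors of [T]. *)
Lemma sumX_twist_minus op v : u != 0 -> th != 0 -> daha_module op ->
  op (genT, false) v = th *: v ->
  sumX (twist u (tau_minus, false) op) v = sumY (twist u (tau_plus, false) op) v.
Proof.
move=> u0 th0 opM Tv.
have := @mod_sumYT _ (@twist_module op (tau_plus, false) u0 th0 opM) v.
rewrite /sumX /sumY /= Tv !linearZ /= linearD !linearZ /=.
rewrite -(mod_X'T' opM) -(mod_Y'T opM) -(mod_YT' opM) -(mod_XT opM) Tv.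
by rewrite !linearZ /= -!scalerDr => /(scalerI th0) <-; rewrite addrC.
Qed.
End DahaModule.

(** * Laurent polynomials and Demazure-Lusztig operators *)

Section LaurentOps.
Context {K : fieldType}.
Implicit Types (f g : laurent K) (a : K).

Lemma opXP n c f g : opX n (c *: f + g) = c *: opX n f + opX n g.
Proof. exact: linext_linear. Qed.

Lemma opsP c f g : ops (c *: f + g) = c *: ops f + ops g.
Proof. exact: linext_linear. Qed.

Lemma opsZ c f : ops (c *: f) = c *: ops f.
Proof. exact: (linearZ_LR (@ops K)). Qed.

Lemma oppiP q4 c f g : oppi q4 (c *: f + g) = c *: oppi q4 f + oppi q4 g.
Proof. exact: linext_linear. Qed.

Lemma ops_Xpow k : ops (Xpow K k) = Xpow K (- k).
Proof. by rewrite /ops linextU scale1r. Qed.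

Lemma oppi_Xpow q4 k : oppi q4 (Xpow K k) = q4 ^ (2 * k) *: Xpow K (- k).
Proof. by rewrite /oppi linextU scale1r. Qed.

Lemma mcoeff_opX n f k : (opX n f)@_k = f@_(k - n).
Proof.
move: f.
pose A f : K^o := (opX n f)@_k; pose B f : K^o := f@_(k - n).
apply: (@eq_laurent_linear K K^o A B) => [c f g|c f g|j].
- by rewrite /A linearP mcoeffD mcoeffZ.
- by rewrite /B mcoeffD mcoeffZ.
by rewrite /A /B opX_Xpow /Xpow !mcoeffU [j == _]eq_sym subr_eq [k == _]eq_sym.
Qed.

(** A nonzero eigenvector would have an infinite support, invariant under
    translation by [n]. *)
Lemma opX_eigen n a f : n != 0 -> opX n f = a *: f -> f = 0.
Proof.
move=> n0 nf; apply/malgP => k; rewrite mcoeff0; apply/eqP/contraT => fk.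
have step j : f@_j != 0 -> f@_(j + n) != 0.
  apply: contraNneq => fjn; have := congr1 (fun g => g@_(j + n)) nf.
  by rewrite /= mcoeff_opX mcoeffZ fjn mulr0 addrK => ->.
pose s := [seq k + n *+ i | i <- iota 0 (size (msupp f)).+1].
have s_uniq : uniq s.
  rewrite map_inj_uniq ?iota_uniq // => i j /addrI.
  by rewrite -!(mulr_natr n) => /(mulfI n0) /eqP; rewrite eqr_nat => /eqP.
have s_sub : {subset s <= msupp f}.
  move=> j /mapP [i _ ->]; rewrite -mcoeff_neq0.
  by elim: i => [|i IHi]; rewrite ?addr0 // mulrSr addrA step.
by have := uniq_leq_size s_uniq s_sub; rewrite size_map size_iota ltnn.
Qed.

Lemma opX_opX m n f : opX m (opX n f) = opX (n + m) f.
Proof.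
move: f; apply: eq_laurent_linear => [c f g|c f g|k]; rewrite ?linearP //.
by rewrite !opX_Xpow addrA.
Qed.

Lemma opX0 f : opX 0 f = f.
Proof.
move: f; apply: eq_laurent_linear => [c f g|c f g|k]; rewrite ?linearP //.
by rewrite opX_Xpow addr0.
Qed.

Lemma opsK : involutive (@ops K).
Proof.
apply: eq_laurent_linear => [c f g|c f g|k]; rewrite ?linearP //.
by rewrite /ops !linextU !scale1r linextU scale1r opprK.
Qed.

Lemma ops_opX n f : ops (opX n f) = opX (- n) (ops f).
Proof.
move: f; apply: eq_laurent_linear => [c f g|c f g|k]; rewrite ?linearP //.
by rewrite opX_Xpow /ops !linextU !scale1r opX_Xpow opprD.
Qed.

Lemma oppi_opX q4 n f : q4 != 0 ->
  oppi q4 (opX n f) = q4 ^ (2 * n) *: opX (- n) (oppi q4 f).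
Proof.
move=> q0; move: f; apply: eq_laurent_linear => [c f g|c f g|k].
- by rewrite !linearP.
- by rewrite !linearP.
rewrite opX_Xpow /oppi !linextU !scale1r linearZ /= opX_Xpow scalerA -expfzDr //.
by rewrite mulrDr addrC opprD.
Qed.

End LaurentOps.

(** The relations of the polynomial representation are consequences of a few
    identities between multiplication by the variable and its inverse, the
    reflection [s], the divided difference [d] and the involution [p].  The
    operator [d] is controlled by its product with the injective operator
    [x ^ 2 - 1]: identities for [d] are checked after applying the latter. *)
Section DemazureLusztig.
Context {K : fieldType} {V : lmodType K} (x x' s d p : {linear V -> V}).
Variables (q4 th : K).
Hypotheses (q0 : q4 != 0) (th0 : th != 0).
Hypotheses (xK : cancel x x') (x'K : cancel x' x) (sK : involutive s).
Hypothesis sx : forall f, s (x f) = x' (s f).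
Hypothesis dE : forall f, x (x (d f)) = d f + (s f - f).
Hypothesis x2_eigen : forall a f, x (x f) = a *: f -> f = 0.
Hypotheses (pK : involutive p) (px : forall f, p (x f) = q4 ^+ 2 *: x' (p f)).
Local Notation c := (th - th^-1).

Definition dlT : {linear V -> V} := (th \*: s \+ c \*: d).
Definition dlTinv : {linear V -> V} := (dlT \- c \*: idfun).

Lemma dlTE f : dlT f = th *: s f + c *: d f. Proof. by []. Qed.
Lemma dlTinvE f : dlTinv f = dlT f - c *: f. Proof. by []. Qed.

Lemma s_mulxV f : s (x' f) = x (s f).
Proof. by rewrite -{2}[f]x'K sx x'K. Qed.

Lemma p_mulxV f : p (x' f) = q4 ^- 2 *: x (p f).
Proof.
by rewrite -[f in RHS]x'K px linearZ /= x'K scalerA mulVf ?scale1r ?expf_neq0.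
Qed.

Lemma x2_sub1_inj f g : x (x f) - f = x (x g) - g -> f = g.
Proof.
move=> fg; apply/subr0_eq/(@x2_eigen 1); rewrite scale1r !linearB /=.
have -> : x (x f) = f + (x (x g) - g) by rewrite -fg addrC subrK.
by rewrite -!addrA [- g + _]addrC addNKr.
Qed.

Lemma d_mulx f : d (x f) = x' (d f) - x' f.
Proof.
apply: x2_sub1_inj; rewrite dE sx [d _ + _]addrC addrK.
have -> : x (x (x' (d f) - x' f)) = x (d f) - x f by rewrite !linearB /= !x'K.
have -> : x (d f) = x' (d f) + (x' (s f) - x' f).
  by rewrite -[LHS]xK dE linearD linearB.
by rewrite addrCA [_ + (_ - _) - x f]addrAC addrK.
Qed.

Lemma s_d f : s (d f) = d f + (s f - f).
Proof.
rewrite -dE; apply: x2_sub1_inj.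
have -> : x (x (x (x (d f)))) - x (x (d f)) = x (x (s f - f)).
  by rewrite -!linearB /= dE [d f + _]addrC addrK.
have := congr1 s (dE f); rewrite !sx [s (_ + _)]linearD [s (_ - _)]linearB /= sK.
move=> sdf; have sd : s (d f) = x' (x' (s (d f))) + (s f - f).
  by rewrite sdf -addrA [f - _ + _]addrA subrK subrr addr0.
rewrite {1}sd.
by rewrite !linearD /= !x'K addrAC subrr add0r.
Qed.

Lemma d_s f : d (s f) = - d f.
Proof.
apply: x2_sub1_inj; rewrite !linearN /= !dE sK [d _ + _]addrC addrK.
by rewrite -opprD [d _ + _]addrC addrK opprB.
Qed.

Lemma d_idem f : d (d f) = d f.
Proof. by apply: x2_sub1_inj; rewrite !dE s_d ![d _ + _]addrC !addrK. Qed.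

Lemma dlT_hecke f : dlT (dlT f) = f + c *: dlT f.
Proof.
rewrite !dlTE !linearD !linearZ /= sK d_s d_idem s_d.
rewrite !(scalerDr, scalerN, scalerA) ![c * th]mulrC.
have -> : th * th = 1 + th * c by field.
rewrite scalerDl scale1r -!addrA; congr (f + _).
by rewrite addrCA [(th * c) *: f + _]addrCA addNKr addrCA addNKr.
Qed.

Lemma dlTx f : dlT (x f) = x' (dlTinv f).
Proof.
by rewrite dlTinvE !dlTE sx d_mulx !(linearD, linearB, linearN, linearZ) /= addrA.
Qed.

Lemma dlTK f : dlTinv (dlT f) = f.
Proof. by rewrite dlTinvE dlT_hecke addrK. Qed.

Lemma dlTVK f : dlT (dlTinv f) = f.
Proof. by rewrite dlTinvE linearB linearZ_LR dlT_hecke addrK. Qed.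

Lemma dlT_TXT f : dlT (x (dlT f)) = x' f.
Proof. by rewrite dlTx dlTK. Qed.

Lemma dlT_YXYX f :
  q4 ^+ 2 *: dlTinv (p (x' (p (dlT (x (dlT (dlT f))))))) = f.
Proof.
rewrite dlT_TXT p_mulxV pK x'K (linearZ_LR dlTinv) dlTK scalerA.
by rewrite divff ?scale1r // expf_neq0.
Qed.

Definition dl_rep (y : daha_letter) : {linear V -> V} :=
  match y with
  | (genX, false) => x
  | (genX, true) => x'
  | (genT, false) => dlT
  | (genT, true) => dlTinv
  | (genY, false) => (p \o dlT)
  | (genY, true) => (dlTinv \o p)
  end.

Lemma dl_rep_module : daha_module q4 th dl_rep.
Proof.
split.
- case=> f; [exact: xK | | exact: dlTK].
  by rewrite -[LHS]/(dlTinv (p (p (dlT f)))) pK dlTK.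
- case=> f; [exact: x'K | | exact: dlTVK].
  by rewrite -[LHS]/(p (dlT (dlTinv (p f)))) dlTVK pK.
- exact: dlT_hecke.
- exact: dlT_TXT.
- by move=> f; rewrite -[LHS]/(dlTinv (p (dlT (dlTinv f)))) dlTVK.
- exact: dlT_YXYX.
Qed.

(** If [T f = t^(1/2) f] and [g = s f - f], multiplying by [X^2 - 1] gives
    [(t^(1/2) X^2 - t^(-1/2)) g = 0], and multiplication by that polynomial is
    injective. *)
Lemma dlT_sym f : dlT f = th *: f -> s f = f.
Proof.
move=> Tf; apply/subr0_eq/(@x2_eigen (th ^- 2)); set g := s f - f.
have cd : c *: d f = - th *: g.
  by rewrite /g scalerBr !scaleNr opprK -Tf dlTE addKr.
apply: (scalerI th0).
have := congr1 (x \o x) cd; rewrite /= !(linearZ_LR x) dE scalerDr cd.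
move/(congr1 -%R); rewrite !scaleNr opprD !opprK => <-.
rewrite -scalerBl scalerA; congr (_ *: _).
by field.
Qed.

(** Multiplication by the Weyl denominator of type [A_1], which turns symmetric
    elements into antisymmetric ones. *)
Definition antisymm : {linear V -> V} := (x \- x').

Lemma antisymmE f : antisymm f = x f - x' f. Proof. by []. Qed.

Lemma antisymm_inj f g : antisymm f = antisymm g -> f = g.
Proof.
move=> fg; apply/subr0_eq/(@x2_eigen 1); rewrite scale1r.
have /eqP : antisymm (f - g) = 0 by rewrite linearB fg subrr.
by rewrite antisymmE subr_eq0 => /eqP ->; rewrite x'K.
Qed.

(** The divided difference disappears because [X - X^-1] clears its
    denominator.  The sums in [antisymm_sumY] and [antisymm_sumXY] have the form
    [t^(1/2) f + T^-1 f] up to a scalar. *)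
Lemma antisymm_dlT f :
  antisymm (th *: f + dlTinv f) =
  th^-1 *: x f - th *: x' f + (th *: x (s f) - th^-1 *: x' (s f)).
Proof.
have -> : th *: f + dlTinv f = th^-1 *: f + (th *: s f + c *: d f).
  rewrite dlTinvE dlTE addrC -addrA addrC; congr (_ + _).
  by rewrite -scaleNr -scalerDl; congr (_ *: _); ring.
have dd : antisymm (d f) = x' (s f) - x' f.
  by rewrite antisymmE -[x (d f)]xK dE linearD linearB /= addrC addKr.
rewrite !linearD (linearZ_LR antisymm) (linearZ_LR antisymm (th - _)) dd.
rewrite (linearZ_LR antisymm) !antisymmE !scalerBr !scalerBl opprB.
set B := th^-1 *: x' f; set D := th *: x' (s f).
rewrite [th *: _ - D + _]addrA [th *: _ - D + _]addrA subrK.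
by rewrite [_ - th^-1 *: x' (s f) + _]addrC addrA; congr (_ + _); rewrite addrA subrK.
Qed.

Lemma antisymm_sumX v : antisymm (x v + x' v) = x (antisymm v) + x' (antisymm v).
Proof. by rewrite linearD !antisymmE linearB linearB xK x'K. Qed.

(* At [t = q] the coefficients in [antisymm_dlT] are the scalars that appear
   when [x] and [x'] move past [p]. *)
Hypothesis thE : th = q4 ^+ 2.

Lemma ps_antisymm v : s v = v ->
  p (s (antisymm v)) = th^-1 *: x (p v) - th *: x' (p v).
Proof.
by move=> sv; rewrite antisymmE !linearB sx s_mulxV sv px p_mulxV thE.
Qed.

Lemma sp_antisymm v :
  s (p (antisymm v)) = th *: x (s (p v)) - th^-1 *: x' (s (p v)).
Proof.
rewrite antisymmE linearB px p_mulxV linearB.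
by rewrite (linearZ_LR s) (linearZ_LR s (q4 ^- 2)) sx s_mulxV thE.
Qed.

Lemma antisymm_sumY v : dlT v = th *: v ->
  antisymm (p (dlT v) + dlTinv (p v)) =
  p (s (antisymm v)) + s (p (antisymm v)).
Proof.
move=> Tv; rewrite ps_antisymm ?sp_antisymm ?(dlT_sym Tv) // Tv.
by rewrite (linearZ_LR p) antisymm_dlT.
Qed.

Lemma antisymm_sumXY v : dlT v = th *: v ->
  antisymm (q4^-1 *: x (p (dlT v)) + q4 *: dlTinv (p (x' v))) =
  q4^-1 *: (x (p (s (antisymm v))) + x' (s (p (antisymm v)))).
Proof.
move=> Tv; rewrite ps_antisymm ?sp_antisymm ?(dlT_sym Tv) // Tv p_mulxV.
rewrite (linearZ_LR p) (linearZ_LR x) (linearZ_LR dlTinv) [q4 *: _]scalerA.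
have -> : q4 * q4 ^- 2 = q4^-1 by field.
rewrite -scalerDr (linearZ_LR antisymm) antisymm_dlT sx !x'K.
congr (_ *: _).
by rewrite !linearB; congr (_ - _ + (_ - _)); rewrite !linearZ_LR ?xK ?x'K.
Qed.

End DemazureLusztig.

(** * Intertwining with the quantum torus *)

(** The sum of [e] over the weights [b, b - 2, ..., - b] of the irreducible
    module of dimension [b + 1].  For [e k = X^k] this is [P_b], and the
    recursion below is [(X + X^-1) P_(b+1) = P_(b+2) + P_b]. *)
Definition string_sum (E : zmodType) (e : int -> E) (b : nat) : E :=
  \sum_(i < b.+1) e (b%:Z - (2 * i)%N%:Z).

Lemma string_sum0 (E : zmodType) (e : int -> E) : string_sum e 0 = e 0.
Proof. by rewrite /string_sum big_ord1 muln0 subr0. Qed.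

Lemma string_sum1 (E : zmodType) (e : int -> E) : string_sum e 1 = e 1 + e (-1).
Proof. rewrite /string_sum big_ord_recr big_ord1 /=; congr (e _ + e _); lia. Qed.

Lemma string_sum_rec (E : zmodType) (e e' : int -> E) b :
  (forall k, e' k = e (k + 1) + e (k - 1)) ->
  string_sum e' b.+1 = string_sum e b.+2 + string_sum e b.
Proof.
move=> e'E; rewrite /string_sum (eq_bigr _ (fun i _ => e'E _)) big_split /=.
rewrite [in RHS]big_ord_recr [X in _ + X = _]big_ord_recr /= addrA [RHS]addrAC.
congr (_ + _ + _); last by congr e; lia.
- by apply: eq_bigr => i _; congr e; lia.
- by apply: eq_bigr => i _; congr e; lia.
Qed.

(** [W] is a projective action of the lattice [Z^2], that is a module over the
    quantum torus, and [D] maps a module over the Hecke algebra to it. *)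
Section Intertwining.
Context {K : fieldType} {V U : lmodType K} (u th : K).
Context (D : {linear V -> U}) (W : int -> int -> {linear U -> U}).
Hypotheses (u0 : u != 0) (th0 : th != 0).
Hypothesis W0 : forall f, W 0 0 f = f.
Hypothesis WM : forall m n m' n' f,
  W m n (W m' n' f) = u ^ (m * n' - m' * n) *: W (m + m') (n + n') f.
Implicit Types (op : daha_letter -> {linear V -> V}) (f : U) (v : V).

Definition weyl_sum m n f := W m n f + W (- m) (- n) f.

Lemma weyl_sumN m n f : weyl_sum (- m) (- n) f = weyl_sum m n f.
Proof. by rewrite /weyl_sum !opprK addrC. Qed.

Lemma weyl_sumM m n m' n' f :
  weyl_sum m n (weyl_sum m' n' f) =
  u ^ (m * n' - m' * n) *: weyl_sum (m + m') (n + n') f +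
  u ^ (m' * n - m * n') *: weyl_sum (m - m') (n - n') f.
Proof.
rewrite /weyl_sum !linearD !WM.
have -> : - m * - n' - - m' * - n = m * n' - m' * n by ring.
have -> : m * - n' - - m' * n = m' * n - m * n' by ring.
have -> : - m * n' - m' * - n = m' * n - m * n' by ring.
rewrite !opprD !opprK.
have shuffle (A B C E : U) : A + B + (C + E) = A + E + (B + C).
  by rewrite [C + E]addrC addrACA.
exact: shuffle.
Qed.

(** [X], [Y] and [q^(-1/4) X Y] correspond to the lattice vectors [(m, n)],
    [(m', n')] and their sum.  The third condition is needed to pass from [X Y]
    to [X^-1 Y] and back when twisting. *)
Definition intertwined op (m n m' n' : int) : Prop :=
  forall v, op (genT, false) v = th *: v ->
  [/\ D (sumX op v) = weyl_sum m n (D v), D (sumY op v) = weyl_sum m' n' (D v) &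
      D (sumY (twist u (tau_plus, false) op) v) =
        weyl_sum (m + m') (n + n') (D v)].

Lemma sumX_eigen op v : daha_module u th op ->
  op (genT, false) v = th *: v ->
  op (genT, false) (sumX op v) = th *: sumX op v.
Proof. by move=> opM Tv; rewrite (mod_sumXT opM) Tv !(linearZ_LR (op _)) -scalerDr. Qed.

Lemma sumY_eigen op v : daha_module u th op ->
  op (genT, false) v = th *: v ->
  op (genT, false) (sumY op v) = th *: sumY op v.
Proof. by move=> opM Tv; rewrite (mod_sumYT opM) Tv !(linearZ_LR (op _)) -scalerDr. Qed.

Lemma twist_plusK op v b : daha_module u th op ->
  sumY (twist u (tau_plus, b) (twist u (tau_plus, ~~ b) op)) v = sumY op v.
Proof.
move=> opM; have [opK opVK _ _ _ _] := opM.
have uu : u * u^-1 = 1 by rewrite divff.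
have uV : u^-1 * u = 1 by rewrite mulVf.
by case: b; rewrite /sumY /= !(linearZ_LR (op _)) !scalerA ?uu ?uV !scale1r ?opK ?opVK.
Qed.

(** The product is resolved in the same way in the Hecke algebra
    ([mul_sumX_sumY]) and in the quantum torus ([weyl_sumM]), so if [D]
    intertwines one of the two smoothings it also intertwines the other. *)
Lemma intertwined_resolution op m n m' n' v : daha_module u th op ->
  m * n' - m' * n = 1 ->
  (forall w, op (genT, false) w = th *: w ->
     D (sumX op w) = weyl_sum m n (D w)) ->
  op (genT, false) v = th *: v -> D (sumY op v) = weyl_sum m' n' (D v) ->
  u *: D (sumY (twist u (tau_plus, false) op) v) +
    u^-1 *: D (sumY (twist u (tau_plus, true) op) v) =
  u *: weyl_sum (m + m') (n + n') (D v) + u^-1 *: weyl_sum (m - m') (n - n') (D v).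
Proof.
move=> opM det1 DX Tv DY.
rewrite -!(linearZ_LR D) -linearD -(mul_sumX_sumY _ u0 opM).
rewrite (DX _ (sumY_eigen opM Tv)) DY weyl_sumM det1.
have -> : m' * n - m * n' = -1 by rewrite -det1; ring.
by rewrite expr1z exprN1.
Qed.

Lemma intertwined_sumXinvY op m n m' n' v : daha_module u th op ->
  m * n' - m' * n = 1 -> intertwined op m n m' n' ->
  op (genT, false) v = th *: v ->
  D (sumY (twist u (tau_plus, true) op) v) = weyl_sum (m' - m) (n' - n) (D v).
Proof.
move=> opM det1 opI Tv; have [_ DY DXY] := opI v Tv.
have DX w : op (genT, false) w = th *: w -> D (sumX op w) = weyl_sum m n (D w).
  by case/opI.
have := intertwined_resolution opM det1 DX Tv DY.
rewrite DXY => /addrI /scalerI -> //; last by rewrite invr_eq0.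
by rewrite -weyl_sumN !opprB.
Qed.

(** Every new sum is one of the old ones, or the second smoothing of a product
    whose first smoothing is already known; for [tau_-] the passage between
    [Y X] and [X Y] is [sumX_twist_minus]. *)
Lemma twist_intertwined op x m n m' n' : daha_module u th op ->
  m * n' - m' * n = 1 -> intertwined op m n m' n' ->
  match x with
  | (tau_plus, false) => intertwined (twist u x op) m n (m + m') (n + n')
  | (tau_plus, true) => intertwined (twist u x op) m n (m' - m) (n' - n)
  | (tau_minus, false) => intertwined (twist u x op) (m + m') (n + n') m' n'
  | (tau_minus, true) => intertwined (twist u x op) (m - m') (n - n') m' n'
  end.
Proof.
move=> opM det1 opI; have [opK opVK _ _ _ _] := opM.
have twM y := twist_module y u0 th0 opM.
have DX w : op (genT, false) w = th *: w -> D (sumX op w) = weyl_sum m n (D w).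
  by case/opI.
have uu : u * u^-1 = 1 by rewrite divff.
have uV : u^-1 * u = 1 by rewrite mulVf.
have uV0 : u^-1 != 0 by rewrite invr_eq0.
case: x => [[] []] v Tv; have [DXv DYv DXYv] := opI v Tv; split=> //.
- exact: intertwined_sumXinvY.
- by rewrite twist_plusK // DYv addrC subrK [n + _]addrC subrK.
- have det1' : m * (n + n') - (m + m') * n = 1 by rewrite -det1; ring.
  have := intertwined_resolution (twM (tau_plus, false)) det1' DX Tv DXYv.
  rewrite (twist_plusK _ true opM) DYv => H; apply: (scalerI u0).
  apply: (addIr (u^-1 *: weyl_sum m' n' (D v))); rewrite H; congr (_ + _ *: _).
  by rewrite -weyl_sumN !opprB [m + _]addrC [n + _]addrC !addrK.
- rewrite -[n - n']opprB -[m - m']opprB weyl_sumN -(intertwined_sumXinvY opM) //.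
  by rewrite /sumX /sumY /= addrC.
- rewrite !subrK -DXv -(sumX_twist_minus u0 th0 (twM (tau_minus, true))) //.
  by rewrite /sumX /= !(linearZ_LR (op _)) !scalerA ?uu ?uV !scale1r ?opK ?opVK.
- by rewrite (sumX_twist_minus u0 th0 opM).
- have det1' : (m + m') * n' - m' * (n + n') = 1 by rewrite -det1; ring.
  have DX' w : op (genT, false) w = th *: w ->
      D (sumX (twist u (tau_minus, false) op) w) = weyl_sum (m + m') (n + n') (D w).
    by move=> Tw; rewrite (sumX_twist_minus u0 th0 opM) //; case: (opI w Tw).
  have := intertwined_resolution (twM (tau_minus, false)) det1' DX' Tv DYv.
  have -> : sumY (twist u (tau_plus, true) (twist u (tau_minus, false) op)) v =
      sumX op v.
    rewrite /sumX /sumY /= !(linearZ_LR (op _)) !scalerA ?uu ?uV !scale1r.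
    by rewrite ?opK ?opVK addrC.
  by rewrite DXv !addrK => /addIr /(scalerI u0).
Qed.

(** Recording the two lattice vectors as columns makes a twist a multiplication
    on the right. *)
Definition intertwined_mx op (M : 'M[int]_2) : Prop :=
  intertwined op (M 0 0) (M 1 0) (M 0 1) (M 1 1).

Lemma tau_mxV x : (tau_mx x)^-1 =
  match x with tau_plus => 1 - delta_mx 0 1 | tau_minus => 1 - delta_mx 1 0 end.
Proof.
set N := (X in _ = X); have MN : tau_mx x * N = 1.
  have dd (i j : 'I_2) : i != j -> (1 + delta_mx i j) * (1 - delta_mx i j) = 1 :> 'M[int]_2.
    move=> ij; rewrite mulrDl mul1r mulrBr mulr1 -[_ * _]/(_ *m _).
    by rewrite mul_delta_mx_0 1?eq_sym // subr0 subrK.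
  by rewrite /N; case: x {N} => /=; rewrite dd.
have [Mu _] := mulmx1_unit MN.
by rewrite -[N](mulKr Mu) MN mulr1.
Qed.

Lemma mul_mx22E (M N : 'M[int]_2) i j :
  (M * N) i j = M i 0 * N 0 j + M i 1 * N 1 j.
Proof.
rewrite -[M * N]/(M *m N) mxE !big_ord_recl big_ord0 addr0.
by congr (_ + M i _ * N _ j); apply/val_inj.
Qed.

Lemma intertwined_psl2 w op (M : 'M[int]_2) : daha_module u th op ->
  M 0 0 * M 1 1 - M 0 1 * M 1 0 = 1 -> intertwined_mx op M ->
  daha_module u th (twists u w op) /\
  intertwined_mx (twists u w op) (M * psl2_proj w).
Proof.
elim: w op M => [|x w IHw] op M opM det1 opI.
  by rewrite /psl2_proj big_nil mulr1.
rewrite /psl2_proj big_cons mulrA.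
apply: IHw; first exact: twist_module.
- rewrite !mul_mx22E -[RHS]det1.
  by case: x => [t []] /=; rewrite ?tau_mxV; case: t; rewrite !mxE /=; ring.
- have := twist_intertwined x opM det1 opI; rewrite /intertwined_mx !mul_mx22E.
case: x => [t []] /=; rewrite ?tau_mxV.
all: case: t; rewrite !mxE /=.
all: rewrite ?(subr0, sub0r, addr0, add0r, mulr0, mulr1, mulrN, mulN1r, mulrN1).
all: by rewrite // ![- _ + _]addrC.
Qed.

(** [P_b] obeys the same three-term recursion on both sides.  It is applied to
    the vector [(X + X^-1) v] rather than to the value of [P_b], so that only
    [v] has to stay in the eigenspace. *)
Lemma intertwined_string_sum op m n b v : daha_module u th op ->
  (forall w, op (genT, false) w = th *: w -> D (sumX op w) = weyl_sum m n (D w)) ->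
  op (genT, false) v = th *: v ->
  D (string_sum (fun k => act op (genpow K genX k) v) b) =
  string_sum (fun k => W (k * m) (k * n) (D v)) b.
Proof.
move=> opM DX.
have addS b0 w : string_sum (fun k => act op (genpow K genX k) (sumX op w)) b0.+1 =
    string_sum (fun k => act op (genpow K genX k) w) b0.+2 +
    string_sum (fun k => act op (genpow K genX k) w) b0.
  apply: string_sum_rec => k; rewrite -(mod_powSr opM) -(mod_powNr opM).
  by rewrite /sumX -[op _ w]scale1r act_linear_r !scale1r.
have addW b0 f : string_sum (fun k => W (k * m) (k * n) (weyl_sum m n f)) b0.+1 =
    string_sum (fun k => W (k * m) (k * n) f) b0.+2 +
    string_sum (fun k => W (k * m) (k * n) f) b0.
  apply: string_sum_rec => k; rewrite /weyl_sum linearD !WM.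
  have -> : k * m * n - m * (k * n) = 0 by ring.
  have -> : k * m * - n - - m * (k * n) = 0 by ring.
  by rewrite expr0z !scale1r !mulrDl !mulNr !mul1r.
(* two consecutive values of [b], for all eigenvectors at once *)
suff [] : (forall v, op (genT, false) v = th *: v ->
    D (string_sum (fun k => act op (genpow K genX k) v) b) =
    string_sum (fun k => W (k * m) (k * n) (D v)) b) /\
  (forall v, op (genT, false) v = th *: v ->
    D (string_sum (fun k => act op (genpow K genX k) v) b.+1) =
    string_sum (fun k => W (k * m) (k * n) (D v)) b.+1) by move=> + _; apply.
elim: b => [|b [IHb IHb1]].
  split=> w Tw; first by rewrite !string_sum0 act1 !mul0r W0.
  by rewrite !string_sum1 /= !expr1 !act_letter -[_ + _]/(sumX op w) DX // !mul1r !mulN1r.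
split=> // w Tw; apply: (addIr (string_sum (fun k => W (k * m) (k * n) (D w)) b)).
by rewrite -addW -DX // -IHb1 ?sumX_eigen // -(IHb _ Tw) -linearD addS.
Qed.

End Intertwining.

(** * The polynomial representation at [t = q] *)

Section PolynomialRep.
Context {K : fieldType} (u : K).
Hypothesis u0 : u != 0.
Local Notation th := (u ^+ 2).
Implicit Types (f v : laurent K) (op : daha_letter -> {linear laurent K -> laurent K}).

Let th0 : th != 0. Proof. exact: expf_neq0. Qed.

Lemma opX1K : cancel (@opX K 1) (opX (-1)).
Proof. by move=> f; rewrite opX_opX opX0. Qed.

Lemma opXN1K : cancel (@opX K (-1)) (opX 1).
Proof. by move=> f; rewrite opX_opX opX0. Qed.

Lemma ops_opX1 f : ops (opX 1 f) = opX (-1) (ops f).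
Proof. exact: ops_opX. Qed.

Lemma opX1_opX1_opdiv f : opX 1 (opX 1 (opdiv f)) = opdiv f + (ops f - f).
Proof. by rewrite -opdivE addrC opX_opX subrK. Qed.

Lemma opX1_opX1_eigen a f : opX 1 (opX 1 f) = a *: f -> f = 0.
Proof. by rewrite opX_opX => /opX_eigen ->. Qed.

Lemma oppi_opX1 f : oppi u (opX 1 f) = u ^+ 2 *: opX (-1) (oppi u f).
Proof. by rewrite oppi_opX // mulr1. Qed.

Definition polyrep : daha_letter -> {linear laurent K -> laurent K} :=
  dl_rep (opX 1) (opX (-1)) (@ops K) (@opdiv K) (oppi u) th.

Lemma polyrepE y f : letter_op u th y f = polyrep y f.
Proof. by case: y => [[] []]. Qed.

Lemma daha_actE h f : daha_act u th h f = act polyrep h f.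
Proof.
rewrite /daha_act /act; apply: eq_bigr => w _; congr (_ *: _).
by elim: (fmonom_val w) => //= y s ->; rewrite polyrepE.
Qed.

Lemma polyrep_module : daha_module u th polyrep.
Proof.
exact: (dl_rep_module u0 th0 opX1K opXN1K (@opsK K) ops_opX1 opX1_opX1_opdiv
  opX1_opX1_eigen (oppiK u0) oppi_opX1).
Qed.

(** The Weyl-ordered monomials [q ^ (- m n / 4) x ^ m y ^ n] of the quantum
    torus, acting on Laurent polynomials through
    [y (X ^ k) = q ^ (- k / 2) X ^ k]. *)
Definition weyl (m n : int) : laurent K -> laurent K :=
  linext (fun k => u ^ (- (m * n) - 2 * k * n) *: Xpow K (k + m)).

HB.instance Definition _ (m n : int) :=
  GRing.isLinear.Build K (laurent K) (laurent K) *:%R (weyl m n)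
    (linext_linear _).

Lemma weyl_Xpow m n k :
  weyl m n (Xpow K k) = u ^ (- (m * n) - 2 * k * n) *: Xpow K (k + m).
Proof. by rewrite /weyl linextU scale1r. Qed.

Lemma weylP m n c f g : weyl m n (c *: f + g) = c *: weyl m n f + weyl m n g.
Proof. exact: linext_linear. Qed.

Lemma weylZ m n c f : weyl m n (c *: f) = c *: weyl m n f.
Proof. exact: (linearZ_LR (weyl m n)). Qed.

Lemma weylB m n f g : weyl m n (f - g) = weyl m n f - weyl m n g.
Proof. exact: (linearB (weyl m n)). Qed.

(* keeps unification from unfolding these operators to finitely supported maps *)
Local Opaque weyl opX ops oppi.

Lemma weylM m n m' n' f :
  weyl m n (weyl m' n' f) = u ^ (m * n' - m' * n) *: weyl (m + m') (n + n') f.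
Proof.
move: f; apply: eq_laurent_linear => [c f g|c f g|k].
- by rewrite !weylP.
- by rewrite weylP scalerDr !scalerA mulrC.
rewrite weyl_Xpow weylZ !weyl_Xpow !scalerA -!expfzDr //.
by congr (_ ^ _ *: Xpow _ _); ring.
Qed.

Lemma weyl0 f : weyl 0 0 f = f.
Proof.
move: f; apply: eq_laurent_linear => [c f g|//|k]; first exact: weylP.
by rewrite weyl_Xpow !mulr0 subr0 oppr0 expr0z scale1r addr0.
Qed.

Lemma weyl_opX n f : weyl n 0 f = opX n f.
Proof.
move: f; apply: eq_laurent_linear => [|c f g|k]; first exact: weylP.
  exact: opXP.
by rewrite weyl_Xpow !mulr0 subr0 oppr0 expr0z scale1r opX_Xpow.
Qed.

Lemma weyl01 f : weyl 0 1 f = oppi u (ops f).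
Proof.
move: f; apply: eq_laurent_linear => [|c f g|k]; first exact: weylP.
  by rewrite opsP oppiP.
rewrite weyl_Xpow ops_Xpow oppi_Xpow opprK.
by congr (_ ^ _ *: Xpow _ _); ring.
Qed.

Lemma weyl0N1 f : weyl 0 (-1) f = ops (oppi u f).
Proof.
move: f; apply: eq_laurent_linear => [|c f g|k]; first exact: weylP.
  by rewrite oppiP opsP.
rewrite weyl_Xpow oppi_Xpow opsZ ops_Xpow opprK.
by congr (_ ^ _ *: Xpow _ _); ring.
Qed.

Definition weyl_lin (m n : int) : {linear laurent K -> laurent K} := weyl m n.

Definition weyl_denom : {linear laurent K -> laurent K} :=
  antisymm (opX 1) (opX (-1)).

Lemma weyl_denom_inj : injective weyl_denom.
Proof. exact: (antisymm_inj opXN1K opX1_opX1_eigen). Qed.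

(** At [t = q], conjugation by the Weyl denominator turns the difference
    operator by which [Y + Y^-1] acts on symmetric polynomials into the sum of
    the shift and its inverse. *)
Lemma polyrep_intertwined :
  intertwined_mx u th weyl_denom weyl_lin polyrep 1.
Proof.
rewrite /intertwined_mx !mxE => v Tv; split.
- rewrite /weyl_sum /weyl_lin /= !oppr0 !weyl_opX.
  exact: (antisymm_sumX opX1K opXN1K).
- rewrite /weyl_sum /weyl_lin /= !oppr0 weyl01 weyl0N1.
  exact: (antisymm_sumY u0 th0 opX1K opXN1K ops_opX1 opX1_opX1_opdiv
    opX1_opX1_eigen oppi_opX1 (erefl _) Tv).
have w11 f : weyl 1 1 f = u^-1 *: opX 1 (oppi u (ops f)).
  have := weylM 1 0 0 1 f : _ = u *: weyl 1 1 f.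
  by rewrite weyl_opX weyl01 => ->; rewrite scalerA mulVf // scale1r.
have w11' f : weyl (-1) (-1) f = u^-1 *: opX (-1) (ops (oppi u f)).
  have := weylM (-1) 0 0 (-1) f : _ = u *: weyl (-1) (-1) f.
  by rewrite weyl_opX weyl0N1 => ->; rewrite scalerA mulVf // scale1r.
rewrite /weyl_sum /weyl_lin /= addr0 add0r w11 w11' -scalerDr.
exact: (antisymm_sumXY u0 th0 opX1K opXN1K ops_opX1 opX1_opX1_opdiv
    opX1_opX1_eigen oppi_opX1 (erefl _) Tv).
Qed.

(** The quotient of [X ^ (m + 1) - X ^ (- m - 1)] by the Weyl denominator, for
    every integer [m]; its oddness about [-1] is that of the colored Jones
    polynomials. *)
Definition macdonald_ext (m : int) : laurent K :=
  match m with
  | Posz n => macdonald_tq K n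
  | Negz 0 => 0
  | Negz n.+1 => - macdonald_tq K n
  end.

Lemma weyl_denom_macdonald m :
  weyl_denom (macdonald_ext m) = Xpow K (m + 1) - Xpow K (- (m + 1)).
Proof.
have tqE n : weyl_denom (macdonald_tq K n) = Xpow K n.+1%:Z - Xpow K (- n.+1%:Z).
  exact: macdonald_tqE.
case: m => [n|[|n]]; first by rewrite tqE -PoszD addn1.
  by rewrite linear0 subrr.
rewrite linearN tqE opprB; congr (Xpow K _ - Xpow K _); lia.
Qed.

Lemma polyrepT1 : polyrep (genT, false) (Xpow K 0) = th *: Xpow K 0.
Proof.
rewrite -[LHS]/(th *: ops (Xpow K 0) + (th - th^-1) *: opdiv (Xpow K 0)).
rewrite ops_Xpow /opdiv linextU scale1r /= big_ord0.
by rewrite !oppr0 scaler0 addr0.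
Qed.

Lemma twists_T (w : psl2_word) op b : twists u w op (genT, b) = op (genT, b).
Proof. by elim: w op => //= x w IHw op; rewrite IHw; case: x => [[] []]. Qed.

Definition cable_step (w : psl2_word) (P : laurent K) : laurent K :=
  daha_down u th (psl2_act u w (laurent_elt P)).

(** After multiplication by the Weyl denominator the left-hand side is the sum
    of the [W(k r, k s)] applied to [X - X^-1].  The terms that come from [X]
    and from [X^-1] recombine into multiples of
    [X^(k r + 1) - X^(- k r - 1)] once [k] is replaced by [- k] in one of the
    two families. *)
Lemma cable_step_macdonald w b :
  cable_step w (macdonald_tq K b) =
  \sum_(i < b.+1)
    (let k : int := (2 * i)%N%:Z - b%:Z in
     u ^ (- (psl2_proj w 1 0 * k * (k * psl2_proj w 0 0 + 2))) *:
     macdonald_ext (psl2_proj w 0 0 * k)).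
Proof.
set r := psl2_proj w 0 0; set s := psl2_proj w 1 0.
have [opM] : daha_module u th (twists u w polyrep) /\
    intertwined_mx u th weyl_denom weyl_lin (twists u w polyrep)
      (1 * psl2_proj w).
  apply: (intertwined_psl2 u0 th0 (weylM : forall m n m' n' f,
    weyl_lin m n (weyl_lin m' n' f) = _ *: weyl_lin _ _ f)).
  - exact: polyrep_module.
  - by rewrite !mxE /= mulr1 mulr0 subr0.
  exact: polyrep_intertwined.
rewrite mul1r => opI; set op := twists u w polyrep in opM opI.
have T1 : op (genT, false) (Xpow K 0) = th *: Xpow K 0.
  by rewrite /op twists_T polyrepT1.
have DX v : op (genT, false) v = th *: v ->
    weyl_denom (sumX op v) = weyl_sum weyl_lin r s (weyl_denom v).
  by move=> Tv; have [DXv _ _] := opI v Tv; exact: DXv.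
have D1 : weyl_denom (Xpow K 0) = Xpow K 1 - Xpow K (-1).
  have <- : macdonald_ext 0 = Xpow K 0.
    by rewrite /= /macdonald_tq big_ord1 muln0 subr0.
  exact: weyl_denom_macdonald.
apply: weyl_denom_inj.
have -> : cable_step w (macdonald_tq K b) =
    string_sum (fun k => act op (genpow K genX k) (Xpow K 0)) b.
  rewrite /cable_step /daha_down daha_actE act_psl2 /laurent_elt.
  rewrite (linear_sum (linext _)) act_sum; apply: eq_bigr => i _.
  by rewrite /= linextU scale1r.
rewrite (intertwined_string_sum weyl0 weylM b opM DX T1) D1.
rewrite (linear_sum weyl_denom).
pose A (k : int) := u ^ (- (s * k * (k * r + 2))) *: Xpow K (r * k + 1).
pose B (k : int) := u ^ (- (s * k * (k * r + 2))) *: Xpow K (- (r * k + 1)).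
transitivity (\sum_(i < b.+1) (A ((2 * i)%N%:Z - b%:Z) - B ((2 * i)%N%:Z - b%:Z))); last first.
  apply: eq_bigr => i _.
  by cbv zeta; rewrite (linearZ_LR weyl_denom) weyl_denom_macdonald scalerBr.
(* reversing the index in the first family only *)
rewrite sumrB (reindex_inj rev_ord_inj) -sumrB; apply: eq_bigr => i _.
rewrite -[weyl_lin _ _ _]/(weyl _ _ (_ - _)).
rewrite weylB !weyl_Xpow /A /B.
have -> : (2 * rev_ord i)%N%:Z - b%:Z = b%:Z - (2 * i)%N%:Z.
  by rewrite /=; have := ltn_ord i; lia.
have -> : (2 * i)%N%:Z - b%:Z = - (b%:Z - (2 * i)%N%:Z) by rewrite opprB.
set k := b%:Z - (2 * i)%N%:Z.
have -> : - (k * r * (k * s)) - 2 * 1 * (k * s) = - (s * k * (k * r + 2)).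
  by ring.
have -> : - (k * r * (k * s)) - 2 * - 1 * (k * s) =
    - (s * - k * (- k * r + 2)) by ring.
have -> : 1 + k * r = r * k + 1 by ring.
by have -> : - 1 + k * r = - (r * - k + 1) by ring.
Qed.

End PolynomialRep.

(** * Spanning by the monomials [X ^ a T ^ e Y ^ b] *)

Section Span.
Context {K : fieldType} {V : lmodType K}.

Inductive spanned (I : Type) (M : I -> V) : V -> Prop :=
| span0 : spanned M 0
| span_cons a i w : spanned M w -> spanned M (a *: M i + w).

Lemma spanD I (M : I -> V) w w' : spanned M w -> spanned M w' -> spanned M (w + w').
Proof.
by move=> + Sw'; elim=> [|a i {}w _ IHw]; rewrite ?add0r // -addrA; apply: span_cons.
Qed.

Lemma spanZ I (M : I -> V) a w : spanned M w -> spanned M (a *: w).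
Proof.
elim=> [|b i {}w _ IHw]; first by rewrite scaler0; exact: span0.
by rewrite scalerDr scalerA; apply: span_cons.
Qed.

Lemma span_gen I (M : I -> V) i : spanned M (M i).
Proof. by rewrite -[M i]scale1r -[_ *: _]addr0; apply/span_cons/span0. Qed.

Lemma span_map I J (M : I -> V) (N : J -> V) (f : {linear V -> V}) w :
  (forall i, spanned N (f (M i))) -> spanned M w -> spanned N (f w).
Proof.
move=> SfM; elim=> [|a i {}w _ IHw]; first by rewrite linear0; exact: span0.
by rewrite linearD linearZ_LR; apply/spanD => //; apply/spanZ.
Qed.

End Span.

Section PBW.
Context {K : fieldType} {V : lmodType K} (u th : K).
Variables (op : daha_letter -> {linear V -> V}) (v0 : V).
Hypotheses (u0 : u != 0) (th0 : th != 0) (opM : daha_module u th op).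
Local Notation X := (op (genX, false)).
Local Notation X' := (op (genX, true)).
Local Notation Y := (op (genY, false)).
Local Notation Y' := (op (genY, true)).
Local Notation T := (op (genT, false)).
Local Notation T' := (op (genT, true)).
Local Notation c := (th - th^-1).
Local Notation pow g k := (act op (genpow K g k)).

(** Monomials of the affine Hecke subalgebra generated by [T] and [Y]. *)
Definition hecke_mon (x : bool * int) : V :=
  pow genT (x.1 : nat)%:Z (pow genY x.2 v0).

Definition pbw_mon (x : int * bool * int) : V :=
  pow genX x.1.1 (hecke_mon (x.1.2, x.2)).

Lemma hecke_monE e b :
  hecke_mon (e, b) = if e then T (pow genY b v0) else pow genY b v0.
Proof. by rewrite /hecke_mon; case: e => /=; rewrite ?expr1 ?act_letter ?act1. Qed.

Lemma hecke_mon0 b : pow genY b v0 = hecke_mon (false, b).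
Proof. by rewrite hecke_monE. Qed.

Lemma hecke_mon1 b : T (pow genY b v0) = hecke_mon (true, b).
Proof. by rewrite hecke_monE. Qed.

Lemma hecke_T w : spanned hecke_mon w -> spanned hecke_mon (T w).
Proof.
apply: span_map => -[e b]; rewrite hecke_monE; case: e.
  rewrite (mod_hecke opM) hecke_mon1 hecke_mon0.
  by apply: spanD; [|apply: spanZ]; apply: span_gen.
by rewrite hecke_mon1; apply: span_gen.
Qed.

Lemma hecke_T' w : spanned hecke_mon w -> spanned hecke_mon (T' w).
Proof.
move=> Sw; rewrite (mod_T'E opM) -scaleNr.
by apply: spanD; [apply: hecke_T | apply: spanZ].
Qed.

Lemma hecke_Y w : spanned hecke_mon w -> spanned hecke_mon (Y w).
Proof.
apply: span_map => -[e b]; rewrite hecke_monE; case: e; last first.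
  by rewrite (mod_powS opM) hecke_mon0; apply: span_gen.
have -> : T (pow genY b v0) = T' (pow genY b v0) + c *: pow genY b v0.
  by rewrite (mod_T'E opM) subrK.
rewrite linearD linearZ_LR (mod_YT' opM) (mod_powS opM) (mod_powN opM) hecke_mon1 hecke_mon0.
by apply: spanD; [|apply: spanZ]; apply: span_gen.
Qed.

Lemma pbw_pow a w : spanned hecke_mon w -> spanned pbw_mon (pow genX a w).
Proof.
elim=> [|b [e n] {}w _ IHw].
  by rewrite act0r; exact: span0.
rewrite act_linear_r; apply/spanD => //; apply/spanZ.
exact: (span_gen pbw_mon (a, e, n)).
Qed.

Lemma pbw_X w : spanned pbw_mon w -> spanned pbw_mon (X w).
Proof.
apply: span_map => -[[a e] b]; rewrite /pbw_mon (mod_powS opM).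
exact: (span_gen pbw_mon (a + 1, e, b)).
Qed.

Lemma pbw_X' w : spanned pbw_mon w -> spanned pbw_mon (X' w).
Proof.
apply: span_map => -[[a e] b]; rewrite /pbw_mon (mod_powN opM).
exact: (span_gen pbw_mon (a - 1, e, b)).
Qed.

Lemma pbw_hecke w : spanned hecke_mon w -> spanned pbw_mon w.
Proof. by move/(pbw_pow 0); rewrite act1. Qed.

(** [T] passes [X^a] up to terms of the same kind, by induction on [a] in both
    directions. *)
Lemma pbw_T w : spanned pbw_mon w -> spanned pbw_mon (T w).
Proof.
apply: span_map => -[[a e] b]; rewrite /pbw_mon /=.
have := span_gen hecke_mon (e, b); set z := hecke_mon _ => Sz.
elim/int_ind: a => [|n IHn|n IHn].
- by rewrite act1; apply/pbw_hecke/hecke_T.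
- rewrite -addn1 PoszD -(mod_powS opM) (mod_TX opM) -scaleNr.
  apply: spanD; first exact: pbw_X'.
  by apply/spanZ/pbw_X'/pbw_pow.
rewrite -addn1 PoszD opprD -(mod_powN opM) (mod_TX' opM).
apply: spanD; first exact: pbw_X.
by apply/spanZ/pbw_X'/pbw_pow.
Qed.

(** [pi = Y T^-1] satisfies [pi X pi^-1 = q^(1/2) X^-1], which makes moving it
    past powers of [X] immediate; together with [X] and [T] it generates the
    Hecke algebra. *)
Lemma mod_YT'X z : Y (T' (X z)) = u ^+ 2 *: X' (Y (T' z)).
Proof.
rewrite (mod_YT' opM) (mod_Y'X u0 opM) (linearZ_LR T) /=.
by rewrite (mod_opVK opM).
Qed.

Lemma mod_YT'X' z : Y (T' (X' z)) = u ^- 2 *: X (Y (T' z)).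
Proof.
rewrite -{2}[z](mod_opVK opM genX) mod_YT'X (linearZ_LR X) (mod_opVK opM).
by rewrite scalerA mulVf ?scale1r // expf_neq0.
Qed.

Lemma pbw_YT' w : spanned pbw_mon w -> spanned pbw_mon (Y (T' w)).
Proof.
rewrite -[Y (T' w)]/((Y \o T') w).
apply: span_map => -[[a e] b]; rewrite /pbw_mon /=.
have := span_gen hecke_mon (e, b); set z := hecke_mon _ => Sz.
elim/int_ind: a => [|n IHn|n IHn].
- by rewrite act1; apply/pbw_hecke/hecke_Y/hecke_T'.
- by rewrite -addn1 PoszD -(mod_powS opM) mod_YT'X; apply/spanZ/pbw_X'.
by rewrite -addn1 PoszD opprD -(mod_powN opM) mod_YT'X'; apply/spanZ/pbw_X.
Qed.

Lemma pbw_letter y w : spanned pbw_mon w -> spanned pbw_mon (op y w).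
Proof.
move=> Sw; case: y => [[] []].
- exact: pbw_X'.
- exact: pbw_X.
- rewrite -(mod_TYT opM) (mod_T'E opM) -scaleNr.
  by apply: spanD; [apply/pbw_T|apply/spanZ]; apply: pbw_YT'.
- by rewrite -[w](mod_opK opM genT); apply/pbw_YT'/pbw_T.
- rewrite (mod_T'E opM) -scaleNr.
  by apply: spanD; [apply/pbw_T|apply/spanZ].
- exact: pbw_T.
Qed.

Lemma pbw_act h : spanned pbw_mon (act op h v0).
Proof.
have S0 : spanned pbw_mon v0.
  have -> : v0 = pbw_mon (0, false, 0) by rewrite /pbw_mon hecke_monE !act1.
  exact: span_gen.
rewrite /act; elim/big_rec: _ => [|w x _ Sx]; first exact: span0.
apply: spanD => //; apply/spanZ.
by elim: (fmonom_val w) => //= y s; apply: pbw_letter.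
Qed.

End PBW.

(** * The Hecke algebra as a module over itself *)

(** The quotient of a vector space by a subspace; the proof of closure under
    scaling is an argument of the type because the module structure depends on
    it. *)
Section SubmodQuotient.
Local Open Scope quotient_scope.
Context {K : fieldType} {V : lmodType K} (I : zmodClosed V).
Hypothesis IZ : GRing.scaler_closed I.

Definition subquot_of (Z : GRing.scaler_closed I) : Type := Quotient.quot I.
Local Notation subquot := (subquot_of IZ).
HB.instance Definition _ := GRing.Zmodule.copy subquot (Quotient.quot I).

Definition to_quot (v : V) : subquot := \pi_(Quotient.quot I) v.
Definition of_quot (q : subquot) : V := repr (q : Quotient.quot I).

Lemma of_quotK : cancel of_quot to_quot.
Proof. by move=> q; rewrite /to_quot /of_quot reprK. Qed.

Lemma to_quot_eq v w : (to_quot v == to_quot w) = (v - w \in I).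
Proof. by rewrite /to_quot -Quotient.idealrBE. Qed.

Lemma to_quotD v w : to_quot (v + w) = to_quot v + to_quot w.
Proof. by rewrite /to_quot !piE. Qed.

Definition scale_quot (a : K) (q : subquot) := to_quot (a *: of_quot q).

Lemma to_quotZ a v : to_quot (a *: v) = scale_quot a (to_quot v).
Proof.
apply/eqP; rewrite /scale_quot to_quot_eq -scalerBr IZ // -to_quot_eq.
by rewrite of_quotK.
Qed.

Lemma quot_ind (P : subquot -> Prop) : (forall v, P (to_quot v)) -> forall q, P q.
Proof. by move=> Pv q; rewrite -[q]of_quotK. Qed.

Fact scale_quotA a b q : scale_quot a (scale_quot b q) = scale_quot (a * b) q.
Proof. by elim/quot_ind: q => v; rewrite -!to_quotZ scalerA. Qed.
Fact scale_quot1 : left_id 1 scale_quot.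
Proof. by elim/quot_ind => v; rewrite -to_quotZ scale1r. Qed.
Fact scale_quotDr : right_distributive scale_quot +%R.
Proof.
move=> a; elim/quot_ind => v; elim/quot_ind => w.
by rewrite -to_quotD -!to_quotZ scalerDr to_quotD.
Qed.
Fact scale_quotDl q : {morph scale_quot^~ q : a b / a + b}.
Proof.
by elim/quot_ind: q => v a b; rewrite -!to_quotZ scalerDl to_quotD.
Qed.

HB.instance Definition _ := GRing.Zmodule_isLmodule.Build K subquot
  scale_quotA scale_quot1 scale_quotDr scale_quotDl.

Lemma to_quot_is_linear : linear to_quot.
Proof. by move=> a v w; rewrite to_quotD to_quotZ. Qed.
HB.instance Definition _ :=
  GRing.isLinear.Build K V subquot *:%R to_quot to_quot_is_linear.

Section Lift.
Variable f : {linear V -> V}.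
Hypothesis fI : forall v, v \in I -> f v \in I.

Definition lift_quot (q : subquot) : subquot := to_quot (f (of_quot q)).

Lemma lift_quotE v : lift_quot (to_quot v) = to_quot (f v).
Proof.
apply/eqP; rewrite /lift_quot to_quot_eq -linearB fI //.
by rewrite -to_quot_eq of_quotK.
Qed.

Lemma lift_quot_is_linear : linear lift_quot.
Proof.
move=> a; elim/quot_ind => v; elim/quot_ind => w.
by rewrite -[_ + _](linearP to_quot) !lift_quotE linearP (linearP to_quot).
Qed.
Definition lift_lin : {linear subquot -> subquot} :=
  HB.pack lift_quot
    (GRing.isLinear.Build K subquot subquot *:%R lift_quot lift_quot_is_linear).

Lemma lift_linE v : lift_lin (to_quot v) = to_quot (f v).
Proof. exact: lift_quotE. Qed.
End Lift.
End SubmodQuotient.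

Lemma hecke_split (K : fieldType) (V : lmodType K) (T : {linear V -> V}) a v :
  a != 0 -> T (T v + a^-1 *: v) + - a *: (T v + a^-1 *: v) = 0 ->
  T (T v) = v + (a - a^-1) *: T v.
Proof.
move=> a0 /eqP; rewrite scaleNr subr_eq0 linearD linearZ_LR scalerDr scalerA.
rewrite divff // scale1r => /eqP TTv; apply: (addIr (a^-1 *: T v)).
by rewrite TTv scalerBl -addrA subrK addrC.
Qed.

(** Left multiplication on an algebra modulo a congruence that contains the
    defining relations.  This turns computations up to a congruence into
    computations with operators, so that the lemmas on [daha_module] apply. *)
Section Regular.
Context {K : fieldType} {A : lalgType K} (u th : K).
Variables (l : daha_letter -> A) (R : A -> A -> Prop).
Hypotheses (u0 : u != 0) (th0 : th != 0).
Local Notation "a ~~ b" := (R a b) (at level 70).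
Hypothesis Rrefl : forall h, h ~~ h.
Hypothesis RD : forall h1 h2 h1' h2',
  h1 ~~ h1' -> h2 ~~ h2' -> h1 + h2 ~~ h1' + h2'.
Hypothesis RM : forall h1 h2 h1' h2',
  h1 ~~ h1' -> h2 ~~ h2' -> h1 * h2 ~~ h1' * h2'.
Hypothesis lZ : forall y a h, l y * (a *: h) = a *: (l y * h).
Local Notation X := (l (genX, false)).
Local Notation X' := (l (genX, true)).
Local Notation Y := (l (genY, false)).
Local Notation Y' := (l (genY, true)).
Local Notation T := (l (genT, false)).
Local Notation T' := (l (genT, true)).
Hypothesis RlK : forall g, l (g, false) * l (g, true) ~~ 1.
Hypothesis RlVK : forall g, l (g, true) * l (g, false) ~~ 1.
Hypothesis Rhecke : (T - th *: 1) * (T + th^-1 *: 1) ~~ 0.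
Hypothesis RTXT : T * X * T ~~ X'.
Hypothesis RTYT : T' * Y * T' ~~ Y'.
Hypothesis RYXYX : u ^+ 2 *: (Y' * X' * Y * X * (T * T)) ~~ 1.

Definition mul_letter (y : daha_letter) (h : A) : A := l y * h.

Lemma mul_letter_is_linear y : linear (mul_letter y).
Proof. by move=> a h h'; rewrite /mul_letter mulrDr lZ. Qed.
HB.instance Definition _ y :=
  GRing.isLinear.Build K A A *:%R (mul_letter y) (mul_letter_is_linear y).

Lemma cong_scale a h h' : h ~~ h' -> a *: h ~~ a *: h'.
Proof.
move=> hh'; rewrite -[h]mul1r -[h']mul1r !scalerAl; exact: RM.
Qed.

Lemma cong_sub h h' : h ~~ h' <-> h - h' ~~ 0.
Proof.
split=> hh'; first by rewrite -(subrr h'); apply: RD.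
by rewrite -[h](subrK h') -[X in _ ~~ X]add0r; apply: RD.
Qed.

Definition cong_null : pred A := fun h => `[< h ~~ 0 >].

Lemma cong_null_closed : zmod_closed cong_null.
Proof.
split=> [|h h' /asboolP h0 /asboolP h'0]; apply/asboolP; first exact: Rrefl.
have := RD h0 (cong_scale (-1) h'0).
by rewrite scaler0 addr0 scaleN1r.
Qed.

Definition null_closed : zmodClosed A :=
  HB.pack cong_null (GRing.isZmodClosed.Build A cong_null cong_null_closed).

Lemma null_scaler : GRing.scaler_closed null_closed.
Proof.
move=> a h /asboolP h0; apply/asboolP.
by have := cong_scale a h0; rewrite scaler0.
Qed.

Lemma null_mul y h : h \in null_closed -> mul_letter y h \in null_closed.
Proof.
move=> /asboolP h0; apply/asboolP; rewrite -[X in _ ~~ X](mulr0 (l y)).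
exact: RM.
Qed.

Definition cong_quot : lmodType K := subquot_of null_scaler.

Definition regular_op (y : daha_letter) : {linear cong_quot -> cong_quot} :=
  lift_lin null_scaler (@null_mul y).

Definition cong_class : {linear A -> cong_quot} := to_quot null_scaler.

Lemma cong_class_eq h h' : cong_class h = cong_class h' <-> h ~~ h'.
Proof.
split=> [/eqP | /cong_sub hh'].
  by rewrite to_quot_eq => /asboolP hh'; apply/cong_sub.
by apply/eqP; rewrite to_quot_eq; apply/asboolP.
Qed.

Lemma regular_opE y h : regular_op y (cong_class h) = cong_class (l y * h).
Proof. exact: lift_linE. Qed.

Lemma cong_class_surj q : exists h, q = cong_class h.
Proof. by elim/(quot_ind (IZ := null_scaler)): q => h; exists h. Qed.

Lemma cong_class_mul a b h : a ~~ b -> cong_class (a * h) = cong_class (b * h).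
Proof. by move=> ab; apply/cong_class_eq/RM. Qed.

Lemma regular_module : daha_module u th regular_op.
Proof.
split=> [g q|g q|q|q|q|q]; have [h ->] := cong_class_surj q.
- by rewrite !regular_opE mulrA (cong_class_mul h (RlVK g)) mul1r.
- by rewrite !regular_opE mulrA (cong_class_mul h (RlK g)) mul1r.
- have linT a v : cong_class ((T + a *: 1) * v) =
      regular_op (genT, false) (cong_class v) + a *: cong_class v.
    by rewrite mulrDl linearD -regular_opE -scalerAl mul1r linearZ_LR.
  apply: hecke_split => //; rewrite -!linT mulrA scaleNr.
  by rewrite (cong_class_mul h Rhecke) mul0r linear0.
- by rewrite !regular_opE !mulrA (cong_class_mul h RTXT).
- by rewrite !regular_opE !mulrA (cong_class_mul h RTYT).
rewrite !regular_opE -(linearZ_LR cong_class) !mulrA -[RHS](congr1 cong_class (mul1r h)).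
by rewrite -(cong_class_mul h RYXYX) -scalerAl !mulrA.
Qed.

End Regular.

(** * Coinvariants as evaluations *)

Section ModuleCongruence.
Context {K : fieldType} {V : lmodType K} (u th : K).
Variable op : daha_letter -> {linear V -> V}.
Hypotheses (opM : daha_module u th op) (th0 : th != 0).

Lemma act_genpow1 g v : act op (genpow K g 1) v = op (g, false) v.
Proof. exact: act_letter. Qed.

Lemma act_genpowN1 g v : act op (genpow K g (-1)) v = op (g, true) v.
Proof. exact: act_letter. Qed.

Lemma act_genpow2 g v : act op (genpow K g 2) v = op (g, false) (op (g, false) v).
Proof. by rewrite /= exprS expr1 actM !act_letter. Qed.

(* distinct letters would otherwise be compared by unfolding them to finitely
   supported maps *)
Opaque genpow letter_elt.

Lemma act_daha_rel h1 h2 v : daha_rel u th h1 h2 -> act op h1 v = act op h2 v.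
Proof.
have [opK opVK hecke TXT TYT YXYX] := opM.
case=> [g|g| | | |].
- by rewrite actM act_genpow1 act_genpowN1 opVK act1.
- by rewrite actM act_genpow1 act_genpowN1 opK act1.
- have actT a w : act op (genpow K genT 1 + a *: 1) w =
      op (genT, false) w + a *: w.
    by rewrite actD actZ act1 act_genpow1.
  have -> : genpow K genT 1 - th *: 1 = genpow K genT 1 + - th *: 1.
    by congr (_ + _); exact: esym (scaleNr _ _).
  rewrite actM 2!actT act0 linearD linearZ_LR hecke scalerDr scalerA mulNr.
  rewrite divff // scaleN1r scaleNr scalerBl.
  by rewrite -[_ + _ + th^-1 *: _]addrA subrK addrA addrK subrr.
- rewrite (actM op (genpow K genT 1 * _)) (actM op (genpow K genT 1)).
  by rewrite !(act_genpow1 genT) (act_genpow1 genX) TXT (act_genpowN1 genX).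
- rewrite (actM op (genpow K genT (-1) * _)) (actM op (genpow K genT (-1))).
  by rewrite !(act_genpowN1 genT) (act_genpow1 genY) TYT (act_genpowN1 genY).
rewrite actZ (actM op (_ * _ * _ * _)) (actM op (_ * _ * _)) (actM op (_ * _)).
rewrite (actM op (genpow K genY (-1))) act_genpow2 (act_genpow1 genX) (act_genpow1 genY).
by rewrite (act_genpowN1 genX) (act_genpowN1 genY) YXYX act1.
Qed.

Transparent genpow letter_elt.

(** Congruent elements act equally on every module, so a coinvariant can be read
    off from the polynomial representation. *)
Lemma act_daha_eq h1 h2 : daha_eq u th h1 h2 ->
  forall v, act op h1 v = act op h2 v.
Proof.
elim=> [{}h1 {}h2 /act_daha_rel //|//|{}h1 {}h2 _ + v|{}h1 {}h2 h3 _ IH1 _ IH2 v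
  |{}h1 {}h2 h1' h2' _ IH1 _ IH2 v|{}h1 {}h2 h1' h2' _ IH1 _ IH2 v].
- by move->.
- by rewrite IH1.
- by rewrite !actD IH1 IH2.
- apply: etrans (actM _ _ _ _) _; rewrite IH2 IH1.
  exact: esym (actM _ _ _ _).
Qed.

Lemma act_pow_eigen g a k v : a != 0 -> op (g, false) v = a *: v ->
  act op (genpow K g k) v = a ^ k *: v.
Proof.
move=> a0 gv.
have g'v : op (g, true) v = a^-1 *: v.
  by rewrite -{2}[v](mod_opK opM g) gv linearZ_LR scalerA mulVf // scale1r.
case: k => k /=.
  elim: k => [|k IHk]; first by rewrite act1 scale1r.
  by rewrite exprSr actM act_letter gv actZr IHk scalerA -exprS.
rewrite -[a ^ Negz k]/(a ^- k.+1) -exprVn.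
elim: k.+1 => [|{}k IHk]; first by rewrite act1 scale1r.
by rewrite exprSr actM act_letter g'v actZr IHk scalerA -exprS.
Qed.

End ModuleCongruence.

Section Lincomb.
Context {K : fieldType} {I : choiceType} {V : lmodType K} (F : I -> V).
Implicit Types g : {malg K[I]}.

Definition lincomb g : V := \sum_(x <- msupp g) g@_x *: F x.

Lemma lincomb_widen g (d : {fset I}) : (msupp g `<=` d)%fset ->
  lincomb g = \sum_(x <- d) g@_x *: F x.
Proof.
move=> le; apply: big_fset_incl => // k _ /mcoeff_outdom ->.
by rewrite scale0r.
Qed.

Lemma lincombD g g' : lincomb (g + g') = lincomb g + lincomb g'.
Proof.
pose d := (msupp (g + g')%R `|` msupp g `|` msupp g')%fset.
rewrite !(@lincomb_widen _ d); first last.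
- by rewrite /d -fsetUA fsubsetUl.
- by rewrite /d fsetUAC fsubsetUr.
- by rewrite /d fsubsetUr.
by rewrite -big_split /=; apply: eq_bigr => x _; rewrite mcoeffD scalerDl.
Qed.

Lemma lincombU a x : lincomb << a *g x >> = a *: F x.
Proof. by rewrite (lincomb_widen msuppU_le) big_seq_fset1 mcoeffUU. Qed.

Lemma spanned_lincomb w : spanned F w -> exists g, w = lincomb g.
Proof.
elim=> [|a x {}w _ [g ->]].
  by exists 0; rewrite /lincomb msupp0 big_seq_fset0.
by exists (<< a *g x >> + g); rewrite lincombD lincombU.
Qed.

End Lincomb.

Section Coinvariant.
Context {K : fieldType} (u th : K).
Hypotheses (u0 : u != 0) (th0 : th != 0).

Lemma letter_mulZ y a (h : daha_free K) :
  letter_elt K y * (a *: h) = a *: (letter_elt K y * h).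
Proof.
have comm_letter : letter_elt K y * a%:MP = a%:MP * letter_elt K y.
  by rewrite !malgM_def !fgmulUU mul1r mulr1 mulm1 mul1m.
rewrite -!mul_malgC mulrA comm_letter; exact: esym (mulrA _ _ _).
Qed.

Local Notation daha_class := (cong_class (@daha_eq_refl K u th) (@daha_eq_add K u th)
  (@daha_eq_mul K u th)).
Local Notation daha_regular := (regular_op (@daha_eq_refl K u th)
  (@daha_eq_add K u th) (@daha_eq_mul K u th) letter_mulZ).

Lemma daha_regular_module : daha_module u th daha_regular.
Proof.
apply: regular_module => //.
- by move=> g; exact: daha_eq_rel (daha_mulgV _ _ g).
- by move=> g; exact: daha_eq_rel (daha_mulVg _ _ g).
- exact: daha_eq_rel (daha_hecke _ _).
- exact: daha_eq_rel (daha_TXT _ _).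
- exact: daha_eq_rel (daha_TYT _ _).
exact: daha_eq_rel (daha_YXYX _ _).
Qed.

Lemma act_regular h : act daha_regular h (daha_class 1) = daha_class h.
Proof.
have foldr_class s : foldr (fun y => daha_regular y) (daha_class 1) s = daha_class << FMonom s >>.
  elim: s => [|y s IHs]; first by rewrite -fmoneE.
  have -> : << FMonom (y :: s) >> = letter_elt K y * << FMonom s >>.
    rewrite /letter_elt malgM_def fgmulUU mulr1; congr << _ >>.
    by apply/eqP; rewrite fmP fmM fmU.
  apply: etrans (congr1 (daha_regular y) IHs) _; exact: regular_opE.
rewrite /act [X in _ = daha_class X]monalgE (linear_sum daha_class).
apply: eq_bigr => w _; rewrite foldr_class fmK -(linearZ_LR daha_class); congr (daha_class _).
by apply/malgP => j; rewrite mcoeffZ !mcoeffU mulrnAr mulr1.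
Qed.

Definition pbw_elt (x : int * bool * int) : daha_free K :=
  genpow K genX x.1.1 * genpow K genT (x.1.2 : nat)%:Z * genpow K genY x.2.

Lemma daha_class_pbw_elt x : daha_class (pbw_elt x) = pbw_mon daha_regular (daha_class 1) x.
Proof.
rewrite -(act_regular (pbw_elt x)) /pbw_elt /pbw_mon /hecke_mon.
rewrite (actM daha_regular (genpow K genX x.1.1 * _)) (actM daha_regular (genpow K genX x.1.1)).
reflexivity.
Qed.

Lemma pbw_exists h : exists g : {malg K[(int * bool * int)%type]},
  daha_eq u th h (lincomb pbw_elt g).
Proof.
have [g hg] := spanned_lincomb (pbw_act (daha_class 1) u0 daha_regular_module h).
exists g; apply/(cong_class_eq (@daha_eq_refl K u th) (@daha_eq_add K u th)
  (@daha_eq_mul K u th)).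
rewrite -act_regular hg /lincomb (linear_sum daha_class); apply: eq_bigr => x _.
by rewrite (linearZ_LR daha_class) daha_class_pbw_elt.
Qed.
End Coinvariant.

Section CoinvariantEval.
Context {K : fieldType} (u : K).
Hypothesis u0 : u != 0.
Local Notation th := (u ^+ 2).

Let th0 : th != 0. Proof. exact: expf_neq0. Qed.

(** Evaluation at [X = t ^ (- 1/2)]. *)
Definition laurent_ev : laurent K -> K^o := linext (fun k => th^-1 ^ k : K^o).
HB.instance Definition _ :=
  GRing.isLinear.Build K (laurent K) K^o *:%R laurent_ev (linext_linear _).

Lemma laurent_evZ a f : laurent_ev (a *: f) = a * laurent_ev f.
Proof. exact: (linearZ_LR laurent_ev). Qed.

Lemma laurent_ev_Xpow k : laurent_ev (Xpow K k) = th^-1 ^ k.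
Proof. by rewrite /laurent_ev linextU scale1r. Qed.

Lemma polyrepY1 : polyrep u (genY, false) (Xpow K 0) = th *: Xpow K 0.
Proof.
rewrite -[LHS]/(oppi u (polyrep u (genT, false) (Xpow K 0))) polyrepT1.
rewrite (linearZ_LR (oppi u)) /= oppi_Xpow.
by rewrite mulr0 expr0z scale1r oppr0.
Qed.

Lemma polyrepX1 k : act (polyrep u) (genpow K genX k) (Xpow K 0) = Xpow K k.
Proof.
elim/int_ind: k => [|n IHn|n IHn]; first exact: act1.
  rewrite -addn1 PoszD -(mod_powS (polyrep_module u0)) IHn.
  exact: opX_Xpow.
rewrite -addn1 PoszD opprD -(mod_powN (polyrep_module u0)) IHn.
exact: opX_Xpow.
Qed.

Lemma laurent_ev_pbw x :
  laurent_ev (act (polyrep u) (pbw_elt x) (Xpow K 0)) =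
  th^-1 ^ x.1.1 * th ^+ (x.1.2 : nat) * th ^ x.2.
Proof.
have pM := polyrep_module u0.
rewrite /pbw_elt (actM _ (genpow K genX x.1.1 * _)).
rewrite (actM _ (genpow K genX x.1.1)).
rewrite (act_pow_eigen pM _ th0 polyrepY1) actZr.
rewrite (act_pow_eigen pM _ th0 (polyrepT1 u)) 2!actZr polyrepX1.
rewrite 2!laurent_evZ.
by rewrite laurent_ev_Xpow mulrC; congr (_ * _); rewrite mulrC.
Qed.

(** [T] and [Y] act on the vector [1] of the polynomial representation by
    [t^(1/2)], as in the definition of the coinvariant, so any expansion in
    monomials evaluates to the same value; [pbw_exists] provides an
    expansion. *)
Lemma is_coinvariantE h c :
  is_coinvariant u th h c <-> c = laurent_ev (daha_down u th h).
Proof.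
have pM := polyrep_module u0.
have ev g : daha_eq u th h (lincomb (@pbw_elt K) g) ->
    \sum_(x <- msupp g) g@_x * (th^-1 ^ x.1.1 * th ^+ (x.1.2 : nat) * th ^ x.2) =
    laurent_ev (daha_down u th h).
  move=> hg; rewrite /daha_down daha_actE (act_daha_eq pM th0 hg).
  rewrite act_sum (linear_sum laurent_ev); apply: eq_bigr => x _.
  by rewrite /= actZ laurent_evZ laurent_ev_pbw.
split=> [[g [hg ->]] | ->]; first exact: ev.
have [g hg] := pbw_exists u0 th0 h.
by exists g; split; [exact: hg | rewrite ev].
Qed.

End CoinvariantEval.

(** * Iterated cables *)

Section Iterated.
Context {K : fieldType} (u : K).
Hypotheses (u0 : u != 0) (u4 : u ^+ 2 - u ^- 2 != 0).
Local Notation th := (u ^+ 2).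
Local Notation v := (u^-1).

Definition jones_value (gam : nat -> psl2_word) (i : nat) (P : laurent K) : K :=
  laurent_ev u (daha_down u th (daha_jones_elt u th gam i P)).

Lemma cable_stepE w P : cable_step u w P =
  act (twists u w (polyrep u)) (laurent_elt P) (Xpow K 0).
Proof. by rewrite -act_psl2; exact: daha_actE. Qed.

Lemma cable_step_linear w : linear (cable_step u w).
Proof.
move=> c f g; rewrite !cable_stepE /laurent_elt.
rewrite linext_linear; exact: act_linear_l.
Qed.

Lemma jones_value_linear gam i :
  linear (jones_value gam i : laurent K -> K^o).
Proof.
elim: i => [|i IHi] c f g.
  have E P : jones_value gam 0 P = laurent_ev u (cable_step u (gam 0) P) by [].
  rewrite !E cable_step_linear; exact: (linearP (laurent_ev u)).
have E P : jones_value gam i.+1 P = jones_value gam i (cable_step u (gam i.+1) P).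
  by [].
rewrite !E cable_step_linear; exact: IHi.
Qed.

Lemma laurent_ev_opX n f : laurent_ev u (opX n f) = th^-1 ^ n * laurent_ev u f.
Proof.
pose A f : K^o := laurent_ev u (opX n f).
pose B f : K^o := th^-1 ^ n *: (laurent_ev u f : K^o).
move: f; apply: (@eq_laurent_linear K K^o A B) => [c f g|c f g|k].
- by rewrite /A opXP (linearP (laurent_ev u)).
- by rewrite /B (linearP (laurent_ev u)) scalerDr !scalerA mulrC.
rewrite /A /B opX_Xpow !laurent_ev_Xpow addrC expfzDr //.
by rewrite invr_eq0 expf_neq0.
Qed.

Lemma laurent_ev_macdonald n :
  laurent_ev u (macdonald_tq K n) = colored_jones v Unknot n.
Proof.
have := congr1 (laurent_ev u) (macdonald_tqE K n).
rewrite !linearB /= !laurent_ev_opX !laurent_ev_Xpow -mulrBl => evP.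
have d0 : v ^+ 2 - v ^- 2 != 0.
  by rewrite !exprVn invrK -opprB oppr_eq0.
apply: (mulfI d0); rewrite /= [RHS]mulrC divfK //.
rewrite expr1z exprN1 invrK in evP.
rewrite !exprM !exprVn invrK evP.
by rewrite -exprnP -invr_expz -exprnP exprVn.
Qed.

Lemma laurent_ev_macdonald_ext m :
  laurent_ev u (macdonald_ext m) =
  odd_extension (colored_jones v Unknot) m.
Proof.
case: m => [n|[|n]] /=; first exact: laurent_ev_macdonald.
  exact: linear0.
exact: etrans (linearN (laurent_ev u) _) (congr1 -%R (laurent_ev_macdonald n)).
Qed.

(** Both sides change sign under [m |-> - m - 2], which fixes [m (m + 2)]. *)
Lemma jones_value_macdonald_ext gam i J a :
  (forall b, jones_value gam i (macdonald_tq K b) =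
     u ^ (- (a * (b * (b + 2))%N%:Z)) * J b) ->
  forall m, jones_value gam i (macdonald_ext m) =
     u ^ (- (a * (m * (m + 2)))) * odd_extension J m.
Proof.
move=> JE; pose F : {linear laurent K -> K^o} := HB.pack (jones_value gam i : laurent K -> K^o)
  (GRing.isLinear.Build _ _ _ _ _ (jones_value_linear gam i)).
have F0 : jones_value gam i 0 = 0 by exact: (linear0 F).
have FN P : jones_value gam i (- P) = - jones_value gam i P.
  exact: (linearN F).
case=> [n|[|n]]; rewrite [macdonald_ext _]/= [odd_extension _ _]/=.
- by rewrite JE.
- by rewrite mulr0.
rewrite FN JE mulrN; congr (- (u ^ (- (a * _)) * _)).
rewrite NegzE; lia.
Qed.

Lemma linear_cable_step w (f : laurent K -> K^o) b : linear f ->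
  f (cable_step u w (macdonald_tq K b)) =
  \sum_(j < b.+1)
    (let k : int := (2 * j)%N%:Z - b%:Z in
     u ^ (- (psl2_proj w 1 0 * k * (k * psl2_proj w 0 0 + 2))) *
     (f (macdonald_ext (psl2_proj w 0 0 * k)) : K)).
Proof.
move=> lf; pose F : {linear laurent K -> K^o} := HB.pack f
  (GRing.isLinear.Build _ _ _ _ _ lf).
rewrite cable_step_macdonald // -[LHS]/(F _) (linear_sum F).
by apply: eq_bigr => j _; exact: (linearZ_LR F).
Qed.

(** Peeling off the innermost polynomial expresses the value for [l + 1] through
    the values for [l] at the weights [k r_(l+1)], and the exponents match
    because
    [a_(l+1) k (k r_(l+1) + 2) = s_(l+1) k (k r_(l+1) + 2) + a_l r_l m (m + 2)]
    for [m = k r_(l+1)]. *)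
Lemma jones_valueE (r s : nat -> int) gam l :
  (forall i, (i <= l)%N ->
     psl2_proj (gam i) 0 0 = r i /\ psl2_proj (gam i) 1 0 = s i) ->
  forall b, jones_value gam l (macdonald_tq K b) =
    u ^ (- (cable_coef r s l * r l * (b * (b + 2))%N%:Z)) *
    colored_jones v (torus_knot_iter r s l) b.
Proof.
have vE n : v ^ n = u ^ (- n) by exact: exprz_inv.
elim: l => [|l IHl] gamE b.
  have [g0 g1] := gamE 0 (leqnn _).
  rewrite -[LHS]/(laurent_ev u (cable_step u (gam 0) (macdonald_tq K b))).
  rewrite (linear_cable_step _ _ (linearP (laurent_ev u))) g0 g1 /=.
  rewrite mulrA vE opprK -expfzDr // addNr expr0z mul1r.
  apply: eq_bigr => j _; rewrite vE laurent_ev_macdonald_ext.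
  by congr (_ ^ _ * _); ring.
have [g0 g1] := gamE l.+1 (leqnn _).
have JE := IHl (fun i il => gamE i (leqW il)).
rewrite -[LHS]/(jones_value gam l (cable_step u (gam l.+1) (macdonald_tq K b))).
rewrite (linear_cable_step _ _ (jones_value_linear gam l)) g0 g1.
rewrite -[torus_knot_iter r s l.+1]/(Cab _ _ (torus_knot_iter r s l)).
rewrite [colored_jones v (Cab _ _ _)]/=.
rewrite mulrA vE opprK -expfzDr // addNr expr0z mul1r.
apply: eq_bigr => j _; cbv zeta; rewrite vE (jones_value_macdonald_ext JE) mulrA -expfzDr //.
by congr (_ ^ _ * _); rewrite /=; ring.
Qed.

End Iterated.

Lemma sqr_sub_inv_neq0 (K : fieldType) (x : K) :
  x != 0 -> x ^+ 4 != 1 -> x ^+ 2 - x ^- 2 != 0.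
Proof.
move=> x0; apply: contraNneq => /eqP; rewrite subr_eq0 => /eqP x22.
by rewrite (exprD x 2 2) {1}x22 mulVf // expf_neq0.
Qed.

Theorem proposition4p2 (l : nat) (r s : nat -> int)
    (gamma : nat -> 'M[int]_2) (gamma_hat : nat -> psl2_word) (b : nat) (c : Qq4) :
  (forall i, (i <= l)%N -> coprimez (r i) (s i)) ->
  (forall i, (i <= l)%N ->
     [/\ \det (gamma i) = 1, gamma i 0 0 = r i & gamma i 1 0 = s i]) ->
  (forall i, (i <= l)%N -> psl2_proj (gamma_hat i) = gamma i) ->
  is_daha_jones_tq q_quarter gamma_hat l b c <->
  c = q_quarter ^ (- (cable_coef r s l * r l * (b * (b + 2))%N%:Z)) *
      colored_jones q_quarter^-1 (torus_knot_iter r s l) b.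
Proof.
move=> _ gammaE gamma_hatE.
have q0 : q_quarter != 0 by rewrite tofrac_eq0 polyX_eq0.
have q4 : q_quarter ^+ 2 - q_quarter ^- 2 != 0.
  apply: (sqr_sub_inv_neq0 q0); apply/eqP => q1.
  have /eqP : tofrac ('X ^+ 4) = tofrac 1 :> Qq4.
    rewrite tofracXn tofrac1; exact: q1.
  by rewrite tofrac_eq => /eqP/(congr1 (fun p : {poly rat} => size p));
    rewrite size_polyXn size_poly1.
rewrite /is_daha_jones_tq is_coinvariantE //.
rewrite -[laurent_ev _ _]/(jones_value q_quarter gamma_hat l (macdonald_tq Qq4 b)).
rewrite (jones_valueE q0 q4 (r := r) (s := s)) // => i il.
by have [_ <- <-] := gammaE i il; rewrite gamma_hatE.
Qed.
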